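(* Let $p\ge 3$ and let $X\sim N_p(\theta,I_p)$ with unknown mean $\theta\in\mathbb{R}^p$. For $a\ge 0$, $b>0$ let $\nu_{a,b}(d\theta)=(a+\|\theta\|^2)^{-b}\,d\theta$. Let $h:\mathbb{R}^p\to[0,\infty)$ be a bounded Borel measurable function and suppose the perturbed prior $\nu_{h,a,b}(d\theta)=h(\theta)\,\nu_{a,b}(d\theta)$ is improper (infinite total mass). If either (A) $a>0$ and $b\in[p/2-1,p/2]$, or (B) $a=0$ and $b\in[p/2-1,p/2)$, then $\nu_{h,a,b}$ is strongly admissible.
   Context: For a statistical model $\{P(\cdot\mid\theta):\theta\in\Theta\}$ on a sample space $\mathcal{X}$ and a $\sigma$-finite measure $\nu$ on $\Theta$, the marginal measure is $M(B)=\int_\Theta P(B\mid\theta)\,\nu(d\theta)$; when $M$ is $\sigma$-finite the formal posterior is a Markov kernel $Q(d\theta\mid x)$ with $P(dx\mid\theta)\nu(d\theta)=Q(d\theta\mid x)M(dx)$ as joint measures. For bounded measurable $\phi:\Theta\to\mathbb{R}$ and estimator $t$, the risk under quadratic loss is $r(t,\theta)=\int (t(x)-\phi(\theta))^2P(dx\mid\theta)$. An estimator $t_0$ is almost-$\nu$-admissible if every estimator $t$ with $r(t,\theta)\le r(t_0,\theta)$ for all $\theta$ satisfies $\nu(\{\theta:r(t,\theta)<r(t_0,\theta)\})=0$. The prior $\nu$ is strongly admissible if for every bounded measurable $\phi$ the formal Bayes estimator $\hat\phi(x)=\int\phi(\theta)Q(d\theta\mid x)$ is almost-$\nu$-admissible.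 *)

(* Defs.v *)
From HB Require Import structures.
From mathcomp Require Import all_boot all_order all_algebra.
From mathcomp Require Import all_classical all_reals all_analysis.
Set Implicit Arguments. Unset Strict Implicit. Unset Printing Implicit Defensive.
Import Order.TTheory GRing.Theory Num.Theory.
Local Open Scope classical_set_scope.
Local Open Scope ring_scope.

(* Euclidean space R^p is represented as p.-tuple R, equipped with the
   library's product sigma-algebra (generated by the coordinates), i.e. the
   Borel sigma-algebra of R^p. *)

(* A measure on R^p is Lebesgue measure iff it gives every closed box its
   volume (boxes with some u_i < l_i are empty and get volume 0). *)
Definition is_lebesgue_measure (R : realType) (p : nat)
    (lam : {measure set (p.-tuple R) -> \bar R}) : Prop :=
  forall l u : p.-tuple R,
    lam [set x | forall i : 'I_p, tnth l i <= tnth x i <= tnth u i] =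
    (\prod_(i < p) Num.max 0 (tnth u i - tnth l i))%:E.

Definition sqnorm (R : realType) (p : nat) (x : p.-tuple R) : R :=
  \sum_(i < p) tnth x i ^+ 2.

Definition sqdist (R : realType) (p : nat) (x y : p.-tuple R) : R :=
  \sum_(i < p) (tnth x i - tnth y i) ^+ 2.

Definition gauss_dens (R : realType) (p : nat) (theta x : p.-tuple R) : R :=
  expR (- sqdist x theta / 2) / (Num.sqrt (2 * pi)) ^+ p.

Definition Pmodel (R : realType) (p : nat)
    (lam : {measure set (p.-tuple R) -> \bar R})
    (theta : p.-tuple R) (B : set (p.-tuple R)) : \bar R :=
  (\int[lam]_(x in B) (gauss_dens theta x)%:E)%E.

Definition prior_dens (R : realType) (p : nat) (h : p.-tuple R -> R) (a b : R)
    (theta : p.-tuple R) : R :=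
  h theta * powR (a + sqnorm theta) (- b).

Definition nu_meas (R : realType) (p : nat)
    (lam : {measure set (p.-tuple R) -> \bar R}) (w : p.-tuple R -> R)
    (A : set (p.-tuple R)) : \bar R :=
  (\int[lam]_(t in A) (w t)%:E)%E.

Definition marginal (R : realType) (p : nat)
    (lam : {measure set (p.-tuple R) -> \bar R}) (w : p.-tuple R -> R)
    (B : set (p.-tuple R)) : \bar R :=
  (\int[lam]_t (Pmodel lam t B * (w t)%:E))%E.

(* Q is a formal posterior: P(dx|theta) nu(dtheta) = Q(dtheta|x) M(dx)
   as joint measures, tested on measurable rectangles A x B; the right-hand
   side  int_B Q(A|x) M(dx)  is written as
   int_theta (int_{x in B} Q(A|x) P(dx|theta)) nu(dtheta). *)
Definition is_formal_posterior (R : realType) (p : nat)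
    (lam : {measure set (p.-tuple R) -> \bar R}) (w : p.-tuple R -> R)
    (Q : R.-pker (p.-tuple R) ~> (p.-tuple R)) : Prop :=
  forall A B : set (p.-tuple R), measurable A -> measurable B ->
    (\int[lam]_(t in A) (Pmodel lam t B * (w t)%:E) =
     \int[lam]_t ((\int[lam]_(x in B) (Q x A * (gauss_dens t x)%:E)) * (w t)%:E))%E.

Definition risk (R : realType) (p : nat)
    (lam : {measure set (p.-tuple R) -> \bar R})
    (phi : p.-tuple R -> R) (t : p.-tuple R -> R) (theta : p.-tuple R) : \bar R :=
  (\int[lam]_x (((t x - phi theta) ^+ 2) * gauss_dens theta x)%:E)%E.

Definition almost_nu_admissible (R : realType) (p : nat)
    (lam : {measure set (p.-tuple R) -> \bar R}) (w : p.-tuple R -> R)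
    (phi : p.-tuple R -> R) (t0 : p.-tuple R -> R) : Prop :=
  forall t : p.-tuple R -> R, measurable_fun setT t ->
    (forall theta, (risk lam phi t theta <= risk lam phi t0 theta)%E) ->
    nu_meas lam w [set theta | (risk lam phi t theta < risk lam phi t0 theta)%E] = 0%E.

Definition bayes_est (R : realType) (p : nat)
    (Q : R.-pker (p.-tuple R) ~> (p.-tuple R)) (phi : p.-tuple R -> R)
    (x : p.-tuple R) : R :=
  fine (\int[Q x]_t (phi t)%:E)%E.

Definition strongly_admissible (R : realType) (p : nat)
    (lam : {measure set (p.-tuple R) -> \bar R}) (w : p.-tuple R -> R) : Prop :=
  sigma_finite setT (marginal lam w) /\
  (exists Q, is_formal_posterior lam w Q) /\
  forall Q, is_formal_posterior lam w Q ->
    forall phi : p.-tuple R -> R, measurable_fun setT phi ->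
      (exists C : R, forall t, `|phi t| <= C) ->
      almost_nu_admissible lam w phi (bayes_est Q phi).

(* Main.v *)
(* Blyth's method.  If [s] dominates the Bayes estimator [psi] of [phi], then for
   every weight [0 <= g <= 1] with [g ^+ 2] integrable under the prior [nu] one has
     int (risk psi - risk s) g^2 dnu
       <= 24 C^2 int int (g(t) - g(x))^2 P(dx | t) nu(dt),
   where [C] bounds [phi]: comparing [g(t)] with the deterministic value [g(x)]
   removes the posterior from the right-hand side, which becomes the energy of
   [g] along one Gaussian step.  Since the prior density is at most of order
   |t|^(2-p) at infinity, its mass at radius r is at most that of r dr, as in
   dimension 2, and the logarithmic cutoffs
     g_n(t) = max(0, 1 - ln(1 + |t|) / (n ln 2))
   have energy O(1/n) while increasing to 1.  Hence the two risks agree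
   nu-almost everywhere.  Everything is measured in the sup norm, whose balls
   are boxes, so that volumes of boxes are all that is needed about Lebesgue
   measure. *)
Require Import Defs.
From HB Require Import structures.
From mathcomp Require Import all_boot all_order all_algebra.
From mathcomp Require Import all_classical all_reals all_analysis.
From mathcomp Require Import measurable_realfun.
From mathcomp Require Import ring lra.
Set Implicit Arguments. Unset Strict Implicit. Unset Printing Implicit Defensive.
Import Order.TTheory GRing.Theory Num.Theory numFieldNormedType.Exports.
Local Open Scope classical_set_scope.
Local Open Scope ring_scope.

(** Blyth's argument usually compares with the Bayes estimator of the prior [g ^+ 2 nu], whose
    posterior then has to be controlled. Here the square is completed pointwise instead. At a fixed
    observation [x] this leaves a remainder of order [(g t - g x) ^+ 2] and one term linear in
    [psi x - phi t], whose coefficient depends on [x] alone; that term integrates to zero because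
    [psi x] is the posterior mean. Two obstacles shape the rest. A formal posterior is tested on
    rectangles only, so every set of parameters comes with its own null set of observations, whereas
    the posterior mean needs a single one. And a Gaussian step has unbounded length, so the
    increment of a cutoff cannot be read off a gradient at [t]; it is bounded with a polynomial loss
    in the length of the step, which the Gaussian density absorbs. The bound [p/2 - 1 <= b] provides
    the critical decay at infinity, and [0 < a] or [b < p/2] the finite mass near the origin. *)

(** * Tonelli on rectangles and binary expansions *)

Section TonelliOn.
Context d1 d2 (T1 : measurableType d1) (T2 : measurableType d2) (R : realType).
Variable m1 : {sigma_finite_measure set T1 -> \bar R}.
Variable m2 : {sigma_finite_measure set T2 -> \bar R}.
Local Open Scope ereal_scope.

(** The indicators of [A] and [B] are absorbed into the integrand [G], which reduces the claim to
    the whole product space. *)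
Lemma fubini_tonelli_on (A : set T1) (B : set T2) (F : T1 * T2 -> \bar R) :
  measurable A -> measurable B ->
  measurable_fun setT F -> (forall z, 0 <= F z) ->
  \int[m1]_(t in A) \int[m2]_(x in B) F (t, x) =
  \int[m2]_(x in B) \int[m1]_(t in A) F (t, x).
Proof.
move=> mA mB mF F0.
pose G z := F z * ((\1_A z.1)%:E * (\1_B z.2)%:E).
have mG : measurable_fun setT G.
  apply: emeasurable_funM => //; apply: emeasurable_funM.
    by apply/measurable_EFinP; apply: (measurableT_comp _ measurable_fst) => //; exact: measurable_indic.
  by apply/measurable_EFinP; apply: (measurableT_comp _ measurable_snd) => //; exact: measurable_indic.
have G0 z : 0 <= G z by rewrite mule_ge0// mule_ge0// lee_fin.
have mF1 t : measurable_fun setT (fun x => F (t, x)).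
  exact: measurableT_comp.
have mF2 x : measurable_fun setT (fun t => F (t, x)).
  exact: measurableT_comp.
transitivity (\int[m1]_t \int[m2]_x G (t, x)).
  rewrite integral_mkcond epatch_indic; apply: eq_integral => t _.
  rewrite integral_mkcond epatch_indic -ge0_integralZr ?lee_fin//.
  - by apply: eq_integral => x _; rewrite /G/= -muleA [X in _ * X]muleC.
  - apply: emeasurable_funM => //; apply/measurable_EFinP; exact: measurable_indic.
  - by move=> x _; rewrite mule_ge0// lee_fin.
rewrite fubini_tonelli// [RHS]integral_mkcond epatch_indic.
apply: eq_integral => x _.
rewrite [in RHS]integral_mkcond epatch_indic -ge0_integralZr ?lee_fin//.
- by apply: eq_integral => t _; rewrite /G/= muleA.
- apply: emeasurable_funM => //; apply/measurable_EFinP; exact: measurable_indic.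
- by move=> t _; rewrite mule_ge0// lee_fin.
Qed.

End TonelliOn.

Section IndicSeries.
Context d (T : measurableType d) (R : realType).

(* Greedy binary expansion of [phi / M], with digits the indicators of [A k]. *)
Lemma bounded_indic_series (phi : T -> R) (M : R) :
  0 <= M -> measurable_fun setT phi -> (forall x, 0 <= phi x <= M) ->
  exists (A : nat -> set T) (c : nat -> R),
    [/\ forall k, measurable (A k), forall k, 0 <= c k &
     forall x, (phi x)%:E = (\sum_(0 <= k <oo) (c k * \1_(A k) x)%:E)%E].
Proof.
move=> M0 mphi phiM.
pose c k : R := M / 2 ^+ k.+1.
pose rest := fix F n : T -> R := if n is k.+1 then
  (fun x => F k x - c k * \1_[set y | c k <= F k y] x) else phi.
pose A k := [set y | c k <= rest k y].
have mA_ k : measurable_fun setT (rest k) -> measurable (A k).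
  move=> mk; rewrite -[A k]setTI.
  rewrite (_ : _ `&` _ = setT `&` (rest k @^-1` `[c k, +oo[)); last first.
    by apply/seteqP; split => y /=; rewrite in_itv/= andbT.
  exact: mk.
have mrest k : measurable_fun setT (rest k).
  elim: k => // k ih /=; apply: measurable_funB => //.
  apply: measurable_funM => //; apply: measurable_indic; exact: mA_.
(* The bound halves with each digit: a remainder of at least [c k] is at most [2 * c k] and loses
   [c k], and a smaller one is already below [c k]. *)
have restP k x : 0 <= rest k x <= M / 2 ^+ k.
  elim: k => [|k /andP[ih0 ih1]] /=; first by rewrite expr0 divr1.
  rewrite indicE; case: (boolP (x \in _)).
    rewrite inE /= mulr1 => h; rewrite subr_ge0 h /= lerBlDr (le_trans ih1)// /c.
    have : (2 ^+ k : R) != 0 by rewrite expf_neq0.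
    by move=> k0; rewrite exprS le_eqVlt; apply/orP; left; apply/eqP; field.
  rewrite notin_setE/= mulr0 subr0 => /negP; rewrite -ltNge => /ltW h.
  by rewrite ih0.
exists A, c; split.
- by move=> k; exact: mA_.
- by move=> k; rewrite divr_ge0// exprn_ge0.
- move=> x; apply/esym/cvg_lim => //.
  have psum n : (\sum_(0 <= k < n) (c k * \1_(A k) x)%:E = (phi x - rest n x)%:E)%E.
    elim: n => [|n ih]; first by rewrite big_geq//= subrr.
    rewrite big_nat_recr//= ih -EFinD; congr EFin; rewrite -/(A n) -/(rest n).
    ring.
  rewrite (eq_cvg _ _ psum).
  apply: cvg_EFin; first by near=> n.
  rewrite -[X in _ --> X]subr0; apply: cvgB; first exact: cvg_cst.
  have geo : (fun n => M / 2 ^+ n) @ \oo --> (0 : R).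
    rewrite (_ : (fun n => M / 2 ^+ n) = geometric M (2^-1)); last first.
      by apply/funext => n; rewrite /geometric/= exprVn.
    by apply: cvg_geometric; rewrite ger0_norm ?invr_ge0// invf_lt1// ltr1n.
  apply: squeeze_cvgr geo; last exact: cvg_cst.
  by near=> n; exact: restP.
Unshelve. all: by end_near. Qed.

End IndicSeries.

(** * Formal posteriors *)

Section FormalPosterior.
Context d (T : measurableType d) (R : realType).
Variable lam : {sigma_finite_measure set T -> \bar R}.
Variable j : T * T -> R.
Hypothesis j0 : forall z, 0 <= j z.
Hypothesis mj : measurable_fun setT j.
Local Open Scope ereal_scope.

(** With [j] the joint density of parameter and observation, this is the unnormalised posterior at
    [x]; its total mass is the marginal density. *)
Definition slice_measure (x : T) (A : set T) : \bar R :=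
  \int[lam]_(t in A) (j (t, x))%:E.

Let jE0 z : 0 <= (j z)%:E. Proof. by rewrite lee_fin. Qed.

Let mjE : measurable_fun setT (EFin \o j).
Proof. exact/measurable_EFinP. Qed.

Let mjl x : measurable_fun setT (fun t => (j (t, x))%:E).
Proof. by apply/measurable_EFinP; exact: measurableT_comp. Qed.

Let mjr t : measurable_fun setT (fun x => (j (t, x))%:E).
Proof. by apply/measurable_EFinP; exact: measurableT_comp. Qed.

Let slice0 x : slice_measure x set0 = 0.
Proof. by rewrite /slice_measure integral_set0. Qed.

Let slice_ge0 x A : 0 <= slice_measure x A.
Proof. by apply: integral_ge0 => t _; exact: jE0. Qed.

Let slice_sigma_additive x : semi_sigma_additive (slice_measure x).
Proof.
move=> F mF tF mUF; rewrite /slice_measure; apply: cvg_toP.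
  apply: ereal_nondecreasing_is_cvgn => m n mn.
  by apply: lee_sum_nneg_natr => // k _ _; exact: slice_ge0.
by rewrite ge0_integral_bigcup//; exact: measurable_funTS.
Qed.

HB.instance Definition _ x := isMeasure.Build _ _ _ (slice_measure x)
  (slice0 x) (slice_ge0 x) (@slice_sigma_additive x).

Let slice_kernel (x : T) : {measure set T -> \bar R} := slice_measure x.

Lemma measurable_slice_measure A : measurable A ->
  measurable_fun setT (slice_measure ^~ A).
Proof.
move=> mA.
pose G z := (j z)%:E * (\1_A z.1)%:E.
rewrite (_ : slice_measure ^~ A = fubini_G lam G).
  apply: measurable_fun_fubini_tonelli_G.
    apply: emeasurable_funM => //; apply/measurable_EFinP.
    by apply: (measurableT_comp _ measurable_fst) => //; exact: measurable_indic.
  by move=> z; rewrite mule_ge0// lee_fin.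
apply/funext => x; rewrite /slice_measure /fubini_G [LHS]integral_mkcond.
by rewrite epatch_indic.
Qed.

Let msk A : measurable A -> measurable_fun setT (slice_kernel ^~ A).
Proof. exact: measurable_slice_measure. Qed.

HB.instance Definition _ := isKernel.Build _ _ _ _ R slice_kernel msk.

Local Notation marg x := (slice_measure x setT).

Hypothesis marg_fin : forall x, marg x < +oo.

(** The defining identity of a formal posterior, with model density and prior weight merged into the
    single joint density [j]. *)
Definition disintegrates (Q : R.-pker T ~> T) := forall A B,
  measurable A -> measurable B ->
  \int[lam]_(t in A) \int[lam]_(x in B) (j (t, x))%:E =
  \int[lam]_t \int[lam]_(x in B) (Q x A * (j (t, x))%:E).

Lemma int_slice A B : measurable A -> measurable B ->
  \int[lam]_(t in A) \int[lam]_(x in B) (j (t, x))%:E =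
  \int[lam]_(x in B) slice_measure x A.
Proof. by move=> mA mB; rewrite (fubini_tonelli_on _ _ mA mB mjE). Qed.

(** Together with [int_slice] this puts both sides of [disintegrates] in the form of integrals over
    [x] in [B], so that their densities in [x] can be compared. *)
Lemma int_kernel_slice (k : T -> \bar R) B : measurable B ->
  measurable_fun setT k -> (forall x, 0 <= k x) ->
  \int[lam]_t \int[lam]_(x in B) (k x * (j (t, x))%:E) =
  \int[lam]_(x in B) (k x * marg x).
Proof.
move=> mB mk k0.
rewrite (fubini_tonelli_on _ _ measurableT mB (F := fun z => k z.2 * (j z)%:E)).
- by apply: eq_integral => x _; rewrite /= ge0_integralZl.
- by apply: emeasurable_funM => //; exact: (measurableT_comp mk measurable_snd).
- by move=> z; rewrite mule_ge0.
Qed.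

(** The kernel is the normalised slice. The measure [dirac t0] is the default of [knormalize] for
    total mass 0 or infinity, and never occurs for a positive finite marginal. *)
Lemma disintegration_exists (t0 : T) (marg_gt0 : forall x, 0 < marg x) :
  exists Q, disintegrates Q.
Proof.
exists (knormalize slice_kernel (dirac t0)) => A B mA mB.
rewrite int_slice// int_kernel_slice//; last exact: measurable_kernel.
apply: eq_integral => x _.
rewrite /knormalize /= /mnormalize /slice_kernel.
rewrite gt_eqF ?marg_gt0// lt_eqF ?marg_fin//=.
have mf : marg x \is a fin_num by rewrite ge0_fin_numE.
rewrite -muleA -[in X in _ * (_ * X)](fineK mf) -EFinM mulVf ?mule1//.
by rewrite fine_eq0// gt_eqF.
Qed.

(** Pieces of finite [lam]-measure are cut down to where the marginal density is at most [n]. They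
    yield the sigma-finiteness of the marginal measure and also localise [ae_disint]. *)
Lemma sigma_finite_marginal : exists F : (set T)^nat, [/\ setT = \bigcup_n F n,
  forall n, measurable (F n) & forall n, \int[lam]_(x in F n) marg x < +oo].
Proof.
have [G UG mG] := sigma_finiteT lam.
have mmarg := measurable_slice_measure (@measurableT _ T).
pose F n := \bigcup_(i in `I_n) G i `&` [set x | marg x <= n%:R%:E].
have mS n : measurable [set x | marg x <= n%:R%:E].
  by rewrite -[X in measurable X]setTI; exact: emeasurable_fun_infty_c.
have mU n : measurable (\bigcup_(i in `I_n) G i).
  by apply: bigcup_measurable => i _; have [] := mG i.
exists F; split.
- apply/esym/seteqP; split => // x _.
  have [i _ Gix] : (\bigcup_i G i) x by rewrite -UG.
  have mf : marg x \is a fin_num by rewrite ge0_fin_numE.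
  (* The successor of [i] is taken because the index set [I_n] contains only the indices strictly
     below [n]. *)
  exists (maxn i.+1 (Num.truncn (fine (marg x))).+1) => //; split.
    by exists i => //=; rewrite leq_max ltnSn.
  rewrite /= -(fineK mf) lee_fin ltW// (lt_le_trans (truncnS_gt _))//.
  by rewrite ler_nat leq_maxr.
- by move=> n; exact: measurableI.
- move=> n; have mF : measurable (F n) by exact: measurableI.
  apply: (@le_lt_trans _ _ (\int[lam]_(x in F n) (cst n%:R%:E) x)).
    apply: ge0_le_integral => //; first exact: measurable_funTS.
    by move=> x [].
  rewrite integral_cst//; apply: lte_mul_pinfty => //.
  apply: (@le_lt_trans _ _ (lam (\bigcup_(i in `I_n) G i))).
    by apply: le_measure; rewrite ?inE//; exact: subIsetl.
  rewrite bigcup_mkord.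
  apply: (@le_lt_trans _ _ (\sum_(i < n) lam (G i))).
    apply: (@Boole_inequality _ _ _ lam (fun i => G i)) => i _.
    by have [] := mG i.
  by apply: lte_sum_pinfty => i _; have [] := mG i.
Qed.

Variable Q : R.-pker T ~> T.
Hypothesis QP : disintegrates Q.

(** On each piece [F n] the slice is integrable, and both sides have equal integrals over every
    measurable subset, hence agree almost everywhere. The exceptional set depends on [A]. *)
Let ae_disint A : measurable A ->
  {ae lam, forall x, Q x A * marg x = slice_measure x A}.
Proof.
move=> mA.
have mmarg := measurable_slice_measure (@measurableT _ T).
have [F [UF mF Ffin]] := sigma_finite_marginal.
have mQ : measurable_fun setT (Q ^~ A) by exact: measurable_kernel.
have mS := measurable_slice_measure mA.
suff : {ae lam, forall x n, F n x -> slice_measure x A = Q x A * marg x}.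
  apply: filterS => x h; have [n _ Fnx] : (\bigcup_n F n) x by rewrite -UF.
  by rewrite -(h n Fnx).
apply/ae_foralln => n; apply: integral_ae_eq => //.
- apply/integrableP; split; first exact: measurable_funTS.
  apply: le_lt_trans (Ffin n); apply: ge0_le_integral => //.
  + by apply: measurable_funTS; exact: measurableT_comp.
  + exact: measurable_funTS.
  + move=> x _; rewrite gee0_abs//; apply: ge0_subset_integral => //.
- by apply: measurable_funTS; exact: emeasurable_funM.
- by move=> E EF mE; rewrite -int_slice// QP// int_kernel_slice.
Qed.

(* Only the countably many level sets of the binary expansion of [phi] are needed,
   so a single null set suffices although [ae_disint] yields one for each set. *)
Lemma ae_posterior_integral (phi : T -> R) (M : R) : (0 <= M)%R ->
  measurable_fun setT phi -> (forall t, 0 <= phi t <= M)%R ->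
  {ae lam, forall x, \int[Q x]_t (phi t)%:E * marg x =
     \int[lam]_t ((phi t)%:E * (j (t, x))%:E)}.
Proof.
move=> M0 mphi phiM.
have [A [c [mA c0 phiE]]] := bounded_indic_series M0 mphi phiM.
have c1 k t : 0 <= (c k * \1_(A k) t)%:E by rewrite lee_fin mulr_ge0.
have mc k : measurable_fun setT (fun t => (c k * \1_(A k) t)%:E).
  by apply/measurable_EFinP; apply: measurable_funM => //; exact: measurable_indic.
have : {ae lam, forall x k, Q x (A k) * marg x = slice_measure x (A k)}.
  by apply/ae_foralln => k; exact: ae_disint.
apply: filterS => x h.
have mx : marg x \is a fin_num by rewrite ge0_fin_numE.
under eq_integral do rewrite phiE.
rewrite integral_nneseries// muleC -(fineK mx) -nneseriesZl; last first.
  by move=> k _; exact: integral_ge0.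
under [RHS]eq_integral => t _.
  rewrite phiE muleC -nneseriesZl//; over.
rewrite integral_nneseries//; last 2 first.
- by move=> k; exact: emeasurable_funM.
- by move=> k t _; rewrite mule_ge0.
apply: eq_eseriesr => k _; rewrite fineK//.
have -> : \int[Q x]_t (c k * \1_(A k) t)%:E = (c k)%:E * Q x (A k).
  under eq_integral do rewrite EFinM.
  rewrite ge0_integralZl_EFin//; last by apply/measurable_EFinP; exact: measurable_indic.
  by rewrite integral_indic// setIT.
rewrite muleCA [marg x * _]muleC h /slice_measure [in LHS]integral_mkcond epatch_indic.
rewrite -ge0_integralZl_EFin//.
- by apply: eq_integral => t _; rewrite EFinM muleCA.
- by move=> t _; rewrite mule_ge0// lee_fin.
- by apply: emeasurable_funM => //; apply/measurable_EFinP; exact: measurable_indic.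
Qed.

End FormalPosterior.

(** * Blyth's inequality *)

Section Blyth.
Context d (T : measurableType d) (R : realType).

(** With [e = psi - phi], [del = s - psi] and [k = g - c], right side minus left side is
    [(del * g + 2 * e * k) ^+ 2] plus [24 C^2 k^2 - (4 e^2 + 2 del e) k^2]. Since [e] and [del] are
    at most [2 C] in absolute value, [4 e^2 <= 16 C^2] and [2 del e <= 8 C^2], which is the origin
    of 24. *)
Lemma blyth_ineq (C psi phi s g c : R) : `|psi| <= C -> `|phi| <= C ->
  `|s| <= C ->
  (psi - phi) ^+ 2 * g ^+ 2 <= (s - phi) ^+ 2 * g ^+ 2 +
    24 * C ^+ 2 * (g - c) ^+ 2 - 2 * (s - psi) * c ^+ 2 * (psi - phi).
Proof.
rewrite !ler_norml => /andP[p1 p2] /andP[f1 f2] /andP[s1 s2].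
pose e := psi - phi; pose del := s - psi; pose k := g - c.
have eC : e ^+ 2 <= 4 * C ^+ 2 by rewrite /e; nra.
have dC : del ^+ 2 <= 4 * C ^+ 2 by rewrite /del; nra.
have edC : 2 * (del * e) <= 8 * C ^+ 2.
  have := sqr_ge0 (e - del); rewrite sqrrB; lra.
have k2 := sqr_ge0 k.
have h1 : 4 * e ^+ 2 * k ^+ 2 + 2 * (del * e) * k ^+ 2 <= 24 * C ^+ 2 * k ^+ 2.
  by rewrite -mulrDl ler_wpM2r//; lra.
have h2 := sqr_ge0 (del * g + 2 * e * k).
rewrite -subr_ge0.
have -> : (s - phi) ^+ 2 * g ^+ 2 + 24 * C ^+ 2 * (g - c) ^+ 2 -
    2 * (s - psi) * c ^+ 2 * (psi - phi) - (psi - phi) ^+ 2 * g ^+ 2 =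
  (del * g + 2 * e * k) ^+ 2 + (24 * C ^+ 2 * k ^+ 2 -
    (4 * e ^+ 2 * k ^+ 2 + 2 * (del * e) * k ^+ 2)).
  by rewrite /del /e /k; ring.
by rewrite addr_ge0// subr_ge0.
Qed.

Definition clamp (C s : R) := Num.max (- C) (Num.min C s).

Lemma clamp_norm (C s : R) : 0 <= C -> `|clamp C s| <= C.
Proof.
move=> C0; rewrite /clamp ler_norml le_max lexx/= ge_max ge_min lexx andbT.
by rewrite (le_trans _ C0)// oppr_le0.
Qed.

Lemma clamp_sqr (C s phi : R) : `|phi| <= C ->
  (clamp C s - phi) ^+ 2 <= (s - phi) ^+ 2.
Proof.
rewrite ler_norml => /andP[p1 p2]; rewrite /clamp.
case: (leP C s) => h1; first by rewrite max_r ?(le_trans p1)//; nra.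
by case: (leP (- C) s) => h2 //; nra.
Qed.

Local Open Scope ereal_scope.
Variable lam : {measure set T -> \bar R}.

(* [q] is the joint density at a fixed observation [x], [mean] says that [psi] is
   the posterior mean, and [c] will be [g x]. *)
Lemma blyth_slice (q g phi : T -> R) (C psi s c : R) :
  measurable_fun setT q -> measurable_fun setT g -> measurable_fun setT phi ->
  (forall t, 0 <= q t)%R -> \int[lam]_t (q t)%:E < +oo ->
  (forall t, `|phi t| <= C)%R -> (`|psi| <= C)%R ->
  (psi + C)%:E * \int[lam]_t (q t)%:E = \int[lam]_t ((phi t + C) * q t)%:E ->
  \int[lam]_t ((psi - phi t) ^+ 2 * g t ^+ 2 * q t)%:E <=
  \int[lam]_t ((s - phi t) ^+ 2 * g t ^+ 2 * q t)%:E +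
  (24 * C ^+ 2)%:E * \int[lam]_t ((g t - c) ^+ 2 * q t)%:E.
Proof.
move=> mq mg mphi q0 qfin phiC psiC mean.
have C0 : (0 <= C)%R by exact: le_trans psiC.
have mR (h : T -> R) : measurable_fun setT h ->
    measurable_fun setT (fun t => (h t * q t)%:E).
  by move=> mh; apply/measurable_EFinP; exact: measurable_funM.
have ms (r : R) : measurable_fun setT (fun t => (r - phi t) ^+ 2 * g t ^+ 2)%R.
  apply: measurable_funM; last exact: measurable_funX.
  by apply: measurable_funX; apply: measurable_funB.
have mgc : measurable_fun setT (fun t => (g t - c) ^+ 2)%R.
  by apply: measurable_funX; exact: measurable_funB.
(* Clamping [s] only lowers the loss and gives the bound [blyth_ineq] needs. *)
pose s' := clamp C s.
apply: (@le_trans _ _ (\int[lam]_t ((s' - phi t) ^+ 2 * g t ^+ 2 * q t)%:E +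
    (24 * C ^+ 2)%:E * \int[lam]_t ((g t - c) ^+ 2 * q t)%:E)); last first.
  apply: leeD2r; apply: ge0_le_integral => //; [|exact: mR|exact: mR|].
    by move=> t _; rewrite lee_fin mulr_ge0// mulr_ge0 ?sqr_ge0.
  move=> t _; rewrite lee_fin ler_wpM2r// ler_wpM2r ?sqr_ge0//.
  exact: clamp_sqr.
have s'C : (`|s'| <= C)%R by exact: clamp_norm.
pose e : R := (2 * (s' - psi) * c ^+ 2)%R.
(* The linear term [e * (psi - phi t)] has integral 0; splitting [e] into its
   positive and negative parts keeps all integrands nonnegative. *)
pose ep := Num.max e 0%R; pose en := Num.max (- e)%R 0%R.
have ep0 : (0 <= ep)%R by rewrite le_max lexx orbT.
have en0 : (0 <= en)%R by rewrite le_max lexx orbT.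
have epn : (ep - en = e)%R.
  by rewrite /ep /en; case: (leP e 0%R) => h1; case: (leP (- e)%R 0%R) => h2; lra.
have phi0 t : (0 <= phi t + C)%R by have := phiC t; rewrite ler_norml; lra.
have psi0 : (0 <= psi + C)%R by move: psiC; rewrite ler_norml; lra.
(* By [mean], [psi + C] and [phi t + C] have the same integral against [q], so only [r1 + r2]
   matters. The shift by [C] makes both nonnegative. *)
have intl (r1 r2 : R) : (0 <= r1)%R -> (0 <= r2)%R ->
    \int[lam]_t ((r1 * (psi + C) + r2 * (phi t + C)) * q t)%:E =
    ((r1 + r2) * (psi + C))%:E * \int[lam]_t (q t)%:E.
  move=> r10 r20.
  under eq_integral do rewrite mulrDl EFinD -2!mulrA EFinM [X in _ + X]EFinM.
  rewrite ge0_integralD//; last 4 first.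
  - by move=> t _; rewrite lee_fin !mulr_ge0.
  - apply: emeasurable_funM => //; apply/measurable_EFinP.
    by apply: measurable_funM => //.
  - by move=> t _; rewrite lee_fin !mulr_ge0.
  - apply: emeasurable_funM => //; apply: mR; exact: measurable_funD.
  rewrite !ge0_integralZl_EFin//; last 4 first.
  - by move=> t _; rewrite lee_fin !mulr_ge0.
  - by apply: mR; exact: measurable_funD.
  - by move=> t _; rewrite lee_fin !mulr_ge0.
  - by apply: mR; exact: measurable_cst.
  rewrite -mean.
  under eq_integral do rewrite EFinM.
  rewrite ge0_integralZl_EFin//; last 2 first.
  - by move=> t _; rewrite lee_fin.
  - exact/measurable_EFinP.
  by rewrite [in RHS]EFinM (EFinD r1 r2) -[RHS]muleA ge0_muleDl ?lee_fin.
have fin_e : ((ep + en) * (psi + C))%:E * \int[lam]_t (q t)%:E \is a fin_num.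
  rewrite fin_numM// ge0_fin_numE//.
  by apply: integral_ge0 => t _; rewrite lee_fin.
(* The same finite amount is added to both sides, expanded on the left with weights [ep], [en] and
   on the right with [en], [ep]. The integrands then differ by [- e * (psi - phi t)], the linear
   term of [blyth_ineq]. *)
rewrite -(leeD2rE _ _ fin_e).
rewrite -{1}(intl ep en)// [(ep + en)%R]addrC -(intl en ep)//.
have mlin r1 r2 : measurable_fun setT
    (fun t => ((r1 * (psi + C) + r2 * (phi t + C)) * q t)%:E).
  apply: mR; apply: measurable_funD => //; apply: measurable_funM => //.
  exact: measurable_funD.
have lin0 r1 r2 t : (0 <= r1)%R -> (0 <= r2)%R ->
    0 <= ((r1 * (psi + C) + r2 * (phi t + C)) * q t)%:E.
  by move=> r10 r20; rewrite lee_fin mulr_ge0// addr_ge0// mulr_ge0.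
have quad0 (r : R) t : 0 <= ((r - phi t) ^+ 2 * g t ^+ 2 * q t)%:E.
  by rewrite lee_fin mulr_ge0// mulr_ge0 ?sqr_ge0.
have dir0 t : 0 <= ((g t - c) ^+ 2 * q t)%:E.
  by rewrite lee_fin mulr_ge0// sqr_ge0.
have K0 : (0 <= 24 * C ^+ 2)%R by rewrite mulr_ge0// sqr_ge0.
rewrite -ge0_integralD//; last 2 first.
- exact: mR.
- by move=> t _; exact: lin0.
rewrite -ge0_integralZl_EFin//; last exact: mR.
rewrite -ge0_integralD//; last 3 first.
- exact: mR.
- by move=> t _; rewrite mule_ge0// lee_fin.
- by apply: emeasurable_funM => //; exact: mR.
rewrite -ge0_integralD//; last 3 first.
- by move=> t _; rewrite adde_ge0// mule_ge0// lee_fin.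
- by apply: emeasurable_funD; [exact: mR|apply: emeasurable_funM => //; exact: mR].
- by move=> t _; exact: lin0.
apply: ge0_le_integral => //.
- by move=> t _; rewrite adde_ge0// lin0.
- by apply: emeasurable_funD => //; exact: mR.
- apply: emeasurable_funD => //; apply: emeasurable_funD; first exact: mR.
  by apply: emeasurable_funM => //; exact: mR.
- move=> t _; rewrite -EFinM -!EFinD lee_fin -subr_ge0.
  have h := blyth_ineq (g t) c psiC (phiC t) s'C.
  rewrite [X in (0 <= X)%R](_ : _ = ((s' - phi t) ^+ 2 * g t ^+ 2 +
    24 * C ^+ 2 * (g t - c) ^+ 2 - e * (psi - phi t) -
    (psi - phi t) ^+ 2 * g t ^+ 2) * q t)%R; last by rewrite -epn; ring.
  by rewrite mulr_ge0// subr_ge0.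
Qed.
End Blyth.

Lemma ereal_le0_harmonic (R : realType) (X : \bar R) (c : R) (N : nat) :
  (forall n, (N <= n)%N -> (X <= (c / n.+1%:R)%:E)%E) -> (X <= 0)%E.
Proof.
case: X => [x| |] h; rewrite ?leNye//.
  rewrite lee_fin leNgt; apply/negP => x0.
  have := h (maxn N (Num.truncn (c / x))) (leq_maxl _ _).
  rewrite lee_fin ler_pdivlMr ?ltr0n// => hx.
  have h2 : c / x < (maxn N (Num.truncn (c / x))).+1%:R.
    apply: lt_le_trans (truncnS_gt _) _.
    by rewrite ler_nat ltnS leq_maxr.
  by move: h2; rewrite ltr_pdivrMr// mulrC ltNge hx.
by have := h N (leqnn N); rewrite leye_eq.
Qed.

Section BlythAdmissible.
Context d (T : measurableType d) (R : realType).
Variable lam : {sigma_finite_measure set T -> \bar R}.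
Variables (f : T * T -> R) (w : T -> R).
Hypothesis f0 : forall z, 0 <= f z.
Hypothesis mf : measurable_fun setT f.
Hypothesis w0 : forall t, 0 <= w t.
Hypothesis mw : measurable_fun setT w.
Variables (phi psi : T -> R) (C : R).
Hypotheses (mphi : measurable_fun setT phi) (mpsi : measurable_fun setT psi).
Hypotheses (phiC : forall t, `|phi t| <= C) (psiC : forall t, `|psi t| <= C).
Local Open Scope ereal_scope.

Let j (z : T * T) : R := (f z * w z.1)%R.
Hypothesis marg_fin : forall x, \int[lam]_t (j (t, x))%:E < +oo.
Hypothesis mean : {ae lam, forall x,
  (psi x + C)%:E * \int[lam]_t (j (t, x))%:E =
  \int[lam]_t ((phi t + C) * j (t, x))%:E}.

Let m1 (h : T -> R) : measurable_fun setT h ->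
  measurable_fun setT (fun z : T * T => h z.1).
Proof. by move=> mh; exact: (measurableT_comp mh measurable_fst). Qed.

Let m2 (h : T -> R) : measurable_fun setT h ->
  measurable_fun setT (fun z : T * T => h z.2).
Proof. by move=> mh; exact: (measurableT_comp mh measurable_snd). Qed.

Let mj : measurable_fun setT j.
Proof. by apply: measurable_funM => //; exact: (m1 mw). Qed.

Let j0 z : (0 <= j z)%R. Proof. exact: mulr_ge0. Qed.

(** The posterior mean identity is available for almost every [x], so Tonelli moves the integral
    over [x] outside and [blyth_slice] is integrated almost everywhere. *)
Lemma blyth_risk (g s : T -> R) :
  measurable_fun setT g -> measurable_fun setT s ->
  \int[lam]_t \int[lam]_x ((psi x - phi t) ^+ 2 * g t ^+ 2 * j (t, x))%:E <=
  \int[lam]_t \int[lam]_x ((s x - phi t) ^+ 2 * g t ^+ 2 * j (t, x))%:E +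
  (24 * C ^+ 2)%:E *
    \int[lam]_t \int[lam]_x ((g t - g x) ^+ 2 * j (t, x))%:E.
Proof.
move=> mg ms.
have K0 : (0 <= 24 * C ^+ 2)%R by rewrite mulr_ge0// sqr_ge0.
pose L (r : T -> R) (z : T * T) : R :=
  ((r z.2 - phi z.1) ^+ 2 * g z.1 ^+ 2 * j z)%R.
pose D (z : T * T) : R := ((g z.1 - g z.2) ^+ 2 * j z)%R.
have L0 r z : 0 <= (L r z)%:E.
  by rewrite lee_fin mulr_ge0// mulr_ge0 ?sqr_ge0.
have D0 z : 0 <= (D z)%:E by rewrite lee_fin mulr_ge0// sqr_ge0.
have mL r : measurable_fun setT r -> measurable_fun setT (EFin \o L r).
  move=> mr; apply/measurable_EFinP; apply: measurable_funM => //.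
  apply: measurable_funM; last by apply: measurable_funX; exact: (m1 mg).
  apply: measurable_funX.
  by apply: measurable_funB; [exact: (m2 mr)|exact: (m1 mphi)].
have mD : measurable_fun setT (EFin \o D).
  apply/measurable_EFinP; apply: measurable_funM => //; apply: measurable_funX.
  by apply: measurable_funB; [exact: (m1 mg)|exact: (m2 mg)].
rewrite (fubini_tonelli _ (mL _ mpsi) (L0 psi)).
rewrite (fubini_tonelli _ (mL _ ms) (L0 s)).
rewrite (fubini_tonelli _ mD D0).
have mGL r : measurable_fun setT r ->
    measurable_fun setT (fun x => \int[lam]_t (L r (t, x))%:E).
  by move=> mr; exact: (measurable_fun_fubini_tonelli_G _ (mL _ mr) (L0 r)).
have mGD : measurable_fun setT (fun x => \int[lam]_t (D (t, x))%:E).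
  exact: (measurable_fun_fubini_tonelli_G _ mD D0).
have iL0 r x : 0 <= \int[lam]_t (L r (t, x))%:E.
  by apply: integral_ge0 => t _; exact: L0.
have iD0 x : 0 <= \int[lam]_t (D (t, x))%:E.
  by apply: integral_ge0 => t _; exact: D0.
have cD0 x : 0 <= (24 * C ^+ 2)%:E * \int[lam]_t (D (t, x))%:E.
  by rewrite mule_ge0.
have mcD : measurable_fun setT
    (fun x => (24 * C ^+ 2)%:E * \int[lam]_t (D (t, x))%:E).
  exact: emeasurable_funM.
rewrite -(ge0_integralZl_EFin _ _ (fun x _ => iD0 x) mGD K0)//.
rewrite -(ge0_integralD _ _ (fun x _ => iL0 s x) (mGL _ ms) (fun x _ => cD0 x) mcD)//.
apply: ae_ge0_le_integral => //.
- by move=> x _; exact: iL0.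
- exact: (mGL _ mpsi).
- by move=> x _; apply: adde_ge0; [exact: iL0|exact: cD0].
- by apply: emeasurable_funD => //; exact: (mGL _ ms).
apply: filterS mean => x meanx _.
apply: (@blyth_slice _ _ _ lam (fun t => j (t, x)) g phi C (psi x) (s x) (g x)) => //.
exact: measurableT_comp.
Qed.

Let risk_ (s : T -> R) (t : T) : \bar R :=
  \int[lam]_x ((s x - phi t) ^+ 2 * f (t, x))%:E.

Variable F0 : R.
Hypothesis f_mass : forall t, \int[lam]_x (f (t, x))%:E <= F0%:E.
Variables (g : nat -> T -> R) (K : R) (E : nat -> set T).
Hypothesis mg : forall n, measurable_fun setT (g n).
Hypothesis g_fin : forall n, \int[lam]_t (g n t ^+ 2 * w t)%:E < +oo.
Hypothesis mE : forall m, measurable (E m).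
Hypothesis cover : forall t, exists m, E m t.
Hypothesis g_half :
  forall m, exists N, forall n t, (N <= n)%N -> E m t -> (1 / 2 <= g n t)%R.
Hypothesis g_dirichlet : forall n,
  \int[lam]_t \int[lam]_x ((g n t - g n x) ^+ 2 * j (t, x))%:E <=
  (K / n.+1%:R)%:E.

(** The risk difference [dd] integrates against [g n ^+ 2 * w] to at most [24 C^2 K / (n + 1)]. On
    [E m] eventually [g n >= 1 / 2], so the integral of [dd * w] over [E m] is at most 4 times this
    for all large [n], hence zero; the sets [E m] cover the space. *)
Lemma blyth_admissible (s : T -> R) : measurable_fun setT s ->
  (forall t, risk_ s t <= risk_ psi t) ->
  \int[lam]_(t in [set t | risk_ s t < risk_ psi t]) (w t)%:E = 0.
Proof.
move=> ms srisk.
have mint (r : T -> R) : measurable_fun setT r ->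
    measurable_fun setT (fun z => ((r z.2 - phi z.1) ^+ 2 * f z)%:E).
  move=> mr; apply/measurable_EFinP; apply: measurable_funM => //.
  apply: measurable_funX; apply: measurable_funB; [exact: (m2 mr)|exact: (m1 mphi)].
have int0 (r : T -> R) z : 0 <= ((r z.2 - phi z.1) ^+ 2 * f z)%:E.
  by rewrite lee_fin mulr_ge0// sqr_ge0.
have mrisk r : measurable_fun setT r -> measurable_fun setT (risk_ r).
  by move=> mr; exact: (measurable_fun_fubini_tonelli_F _ (mint r mr) (int0 r)).
have risk0 r t : 0 <= risk_ r t.
  by apply: integral_ge0 => x _; exact: (int0 r (t, x)).
have mintl (r : T -> R) t : measurable_fun setT r ->
    measurable_fun setT (fun x => ((r x - phi t) ^+ 2 * f (t, x))%:E).
  by move=> mr; exact: (measurableT_comp (mint r mr) (pair1_measurable t)).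
have mfl t : measurable_fun setT (fun x => (f (t, x))%:E).
  by apply/measurable_EFinP; exact: measurableT_comp.
have risk_psi t : risk_ psi t <= (4 * C ^+ 2 * F0)%:E.
  have C4 : (0 <= 4 * C ^+ 2)%R by rewrite mulr_ge0// sqr_ge0.
  apply: (@le_trans _ _ (\int[lam]_x ((4 * C ^+ 2)%:E * (f (t, x))%:E))).
    apply: ge0_le_integral => //.
    - by move=> x _; exact: (int0 psi (t, x)).
    - exact: mintl.
    - exact: emeasurable_funM.
    move=> x _; rewrite -EFinM lee_fin ler_wpM2r//.
    have := psiC x; have := phiC t; rewrite !ler_norml => /andP[? ?] /andP[? ?].
    nra.
  rewrite ge0_integralZl_EFin//; last by move=> x _; rewrite lee_fin.
  by rewrite [leRHS]EFinM lee_wpmul2l// lee_fin.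
have fin_psi t : risk_ psi t \is a fin_num.
  by rewrite ge0_fin_numE// (le_lt_trans (risk_psi t))// ltry.
have fin_s t : risk_ s t \is a fin_num.
  rewrite ge0_fin_numE// (le_lt_trans (srisk t))//.
  by rewrite -ge0_fin_numE.
pose dd t := risk_ psi t - risk_ s t.
have dd0 t : 0 <= dd t by rewrite sube_ge0// fin_s.
have mdd : measurable_fun setT dd by apply: emeasurable_funB; exact: mrisk.
have mG n : measurable_fun setT (fun t => (g n t ^+ 2 * w t)%:E).
  apply/measurable_EFinP; apply: measurable_funM => //; exact: measurable_funX.
have G0 n t : 0 <= (g n t ^+ 2 * w t)%:E by rewrite lee_fin mulr_ge0// sqr_ge0.
have riskG (r : T -> R) n t : measurable_fun setT r ->
    \int[lam]_x ((r x - phi t) ^+ 2 * g n t ^+ 2 * j (t, x))%:E =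
    risk_ r t * (g n t ^+ 2 * w t)%:E.
  move=> mr; rewrite /risk_ -ge0_integralZr//; last 2 first.
  - exact: mintl.
  - by move=> x _; exact: (int0 r (t, x)).
  apply: eq_integral => x _; rewrite -EFinM; congr EFin; rewrite /j/=; ring.
(* This finiteness, due to [g_fin], allows the weighted risk of [s] to be cancelled from both sides
   of [blyth_risk]. *)
have sG n : \int[lam]_t (risk_ s t * (g n t ^+ 2 * w t)%:E) \is a fin_num.
  rewrite ge0_fin_numE; last by apply: integral_ge0 => t _; exact: mule_ge0.
  apply: (@le_lt_trans _ _
    (\int[lam]_t ((4 * C ^+ 2 * F0)%:E * (g n t ^+ 2 * w t)%:E))).
    apply: ge0_le_integral => //.
    - by move=> t _; exact: mule_ge0.
    - by apply: emeasurable_funM => //; exact: mrisk.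
    - exact: emeasurable_funM.
    by move=> t _; rewrite lee_wpmul2r// (le_trans (srisk t)).
  (* The sign is read off from a nonnegative risk at some point of [T]; if there is no point, the
     integral vanishes. *)
  have t0F : (0 <= 4 * C ^+ 2 * F0)%R \/ (forall t : T, False).
    case: (pselect (exists t : T, True)) => [[t _]|nt].
      by left; rewrite -lee_fin; exact: le_trans (risk_psi t).
    by right => t; apply: nt; exists t.
  case: t0F => [F00|Tempty].
    by rewrite ge0_integralZl_EFin// lte_mul_pinfty// lee_fin.
  by rewrite (_ : setT = set0) ?integral_set0//; apply/seteqP; split => t.
have ddG n : \int[lam]_t (dd t * (g n t ^+ 2 * w t)%:E) <=
    (24 * C ^+ 2 * (K / n.+1%:R))%:E.
  have := blyth_risk (mg n) ms.
  under eq_integral do rewrite (riskG psi n _ mpsi).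
  under [X in _ <= X + _]eq_integral do rewrite (riskG s n _ ms).
  under eq_integral => t _.
    rewrite (_ : risk_ psi t = dd t + risk_ s t); last by rewrite subeK.
    rewrite ge0_muleDl//; over.
  rewrite ge0_integralD//; last 4 first.
  - by move=> t _; exact: mule_ge0.
  - exact: emeasurable_funM.
  - by move=> t _; exact: mule_ge0.
  - by apply: emeasurable_funM => //; exact: mrisk.
  rewrite addeC leeD2lE// => h; apply: (le_trans h).
  by rewrite [leRHS]EFinM lee_wpmul2l// lee_fin mulr_ge0// sqr_ge0.
have ddw0 m : {ae lam, forall t, E m t -> dd t * (w t)%:E = 0}.
  have mddw : measurable_fun setT (fun t => dd t * (w t)%:E).
    by apply: emeasurable_funM => //; exact/measurable_EFinP.
  have ddwge0 t : 0 <= dd t * (w t)%:E by rewrite mule_ge0// lee_fin.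
  apply/(ae_eq_integral_abs lam (mE m)); first exact: measurable_funTS.
  under eq_integral do rewrite gee0_abs//.
  apply/eqP; rewrite eq_le; apply/andP; split; last exact: integral_ge0.
  have [N gN] := g_half m.
  apply: (@ereal_le0_harmonic _ _ (4 * (24 * C ^+ 2 * K)) N) => n Nn.
  apply: (@le_trans _ _ (\int[lam]_(t in E m) (4%:E * (dd t * (g n t ^+ 2 * w t)%:E)))).
    apply: ge0_le_integral => //.
    - exact: measurable_funTS.
    - apply: measurable_funTS; apply: emeasurable_funM => //.
      exact: emeasurable_funM.
    move=> t Emt; rewrite muleCA lee_wpmul2l// -EFinM lee_fin mulrA ler_peMl//.
    have := gN n t Nn Emt; nra.
  apply: (@le_trans _ _ (\int[lam]_t (4%:E * (dd t * (g n t ^+ 2 * w t)%:E)))).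
    apply: ge0_subset_integral => //.
    - by apply: emeasurable_funM => //; exact: emeasurable_funM.
    - by move=> t _; rewrite mule_ge0// mule_ge0.
  rewrite ge0_integralZl_EFin//; last 2 first.
  - by move=> t _; exact: mule_ge0.
  - exact: emeasurable_funM.
  rewrite (_ : 4 * _ / _ = 4 * (24 * C ^+ 2 * (K / n.+1%:R)))%R; last by ring.
  by rewrite EFinM lee_wpmul2l// lee_fin.
have mS : measurable [set t | risk_ s t < risk_ psi t].
  rewrite (_ : mkset _ = setT `&` [set t | 0 < dd t]).
    exact: emeasurable_fun_o_infty.
  by rewrite setTI; apply/seteqP; split => t /=; rewrite sube_gt0.
rewrite -(integral0 lam [set t | risk_ s t < risk_ psi t]).
apply: ge0_ae_eq_integral => //.
- by apply: measurable_funTS; exact/measurable_EFinP.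
- by move=> t _; rewrite lee_fin.
have : {ae lam, forall t m, E m t -> dd t * (w t)%:E = 0} by exact/ae_foralln.
apply: filterS => t h /= St.
have [m Emt] := cover t; have /eqP := h m Emt.
by rewrite mule_eq0 => /orP[|/eqP//]; rewrite gt_eqF// sube_gt0.
Qed.

End BlythAdmissible.

(** * Sup-norm balls and layer estimates *)

Section Dyadic.
Variable R : realType.

Lemma dyadic_scale (y : R) : 1 <= y -> exists k, 2 ^+ k <= y < 2 ^+ k.+1.
Proof.
move=> y1; have y0 : 0 <= y by lra.
have /andP[h1 h2] := truncn_itv y0.
have m1 : (0 < Num.truncn y)%N by rewrite -(ltr_nat R); lra.
exists (trunc_log 2 (Num.truncn y)); have /andP[t1 t2] := trunc_log_bounds (ltnSn 1) m1.
apply/andP; split.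
  by apply: le_trans h1; rewrite -natrX ler_nat.
by apply: lt_le_trans h2 _; rewrite -natrX ler_nat.
Qed.

Lemma eseries_geometric (a q : R) : 0 <= q < 1 ->
  (\sum_(0 <= k <oo) (a * q ^+ k)%:E = (a / (1 - q))%:E)%E.
Proof.
move=> /andP[q0 q1]; apply/cvg_lim => //.
under eq_fun do rewrite sumEFin.
apply: cvg_EFin; first by near=> n.
by apply: cvg_geometric_series; rewrite ger0_norm.
Unshelve. all: by end_near. Qed.

Lemma eseries_trunc (c : nat -> R) (K : nat) : (forall k, (K < k)%N -> c k = 0) ->
  (\sum_(0 <= k <oo) (c k)%:E = (\sum_(0 <= k < K.+1) c k)%:E)%E.
Proof.
move=> cK; apply/cvg_lim => //.
apply: cvg_near_cst; exists K.+1 => // n /= Kn.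
rewrite sumEFin (big_cat_nat (leq0n _) Kn)/= [X in (_ + X)%:E]big_nat_cond.
rewrite [X in (_ + X)%:E]big1 ?addr0// => k /andP[/andP[Kk _] _].
exact: cK.
Qed.

End Dyadic.

Section SupDistance.
Context (R : realType) (p : nat).
Implicit Types x y z : p.-tuple R.

Definition dinf x y : R := \big[Num.max/0]_(i < p) `|tnth x i - tnth y i|.

Lemma dinf_ge0 x y : 0 <= dinf x y.
Proof. exact: bigmax_ge_id. Qed.

Lemma dinf_leP x y r : 0 <= r ->
  reflect (forall i, `|tnth x i - tnth y i| <= r) (dinf x y <= r).
Proof.
move=> r0; apply: (iffP (bigmax_leP _ _ _ _)) => [[_ h] i|h]; first exact: h.
by split=> // i _; exact: h.
Qed.

Lemma dinf_coord x y i : `|tnth x i - tnth y i| <= dinf x y.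
Proof. exact: le_bigmax. Qed.

Lemma dinfC x y : dinf x y = dinf y x.
Proof. by apply: eq_bigr => i _; rewrite distrC. Qed.

Lemma dinf_triangle x y z : dinf x z <= dinf x y + dinf y z.
Proof.
apply/dinf_leP => [|i]; first by rewrite addr_ge0 ?dinf_ge0.
rewrite -(subrKA (tnth y i)) (le_trans (ler_normD _ _))// lerD//;
  exact: dinf_coord.
Qed.

(** Upper bounds use this direction: the Gaussian density and the power in the prior decrease with
    the Euclidean distance. *)
Lemma dinf_sqr_le x y : dinf x y ^+ 2 <= sqdist x y.
Proof.
have S0 : 0 <= sqdist x y by apply: sumr_ge0 => i _; exact: sqr_ge0.
rewrite -(sqr_sqrtr S0) ler_sqr ?nnegrE ?dinf_ge0 ?sqrtr_ge0//.
apply/dinf_leP => [|i]; first exact: sqrtr_ge0.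
rewrite -sqrtr_sqr ler_wsqrtr// /sqdist (bigD1 i)//= lerDl.
by apply: sumr_ge0 => k _; exact: sqr_ge0.
Qed.

Definition origin : p.-tuple R := [tuple 0 | i < p].
Definition ninf x := dinf x origin.

Lemma ninf_sqr_le x : ninf x ^+ 2 <= sqnorm x.
Proof.
apply: le_trans (dinf_sqr_le _ _) _; apply: ler_sum => i _.
by rewrite tnth_mktuple subr0.
Qed.

Lemma ninf_ge0 x : 0 <= ninf x. Proof. exact: dinf_ge0. Qed.

Lemma ninf_dist x y : `|ninf x - ninf y| <= dinf x y.
Proof.
have h1 := dinf_triangle x y origin; have h2 := dinf_triangle y x origin.
by rewrite (dinfC y x) in h2; rewrite ler_distl /ninf; apply/andP; split; lra.
Qed.

Lemma measurable_dinf_comp d (X : measurableType d) (f g : X -> p.-tuple R) :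
  measurable_fun setT f -> measurable_fun setT g ->
  measurable_fun setT (fun v => dinf (f v) (g v)).
Proof.
move=> mf mg; rewrite /dinf; elim: (index_enum _) => [|i s ih].
  by under eq_fun do rewrite big_nil; exact: measurable_cst.
under eq_fun do rewrite big_cons.
apply: measurable_maxr => //; apply: measurableT_comp => //.
by apply: measurable_funB; exact: (measurableT_comp (measurable_tnth i)).
Qed.

Lemma measurable_dinfl y : measurable_fun setT (dinf^~ y).
Proof. exact: measurable_dinf_comp. Qed.

Lemma measurable_ball y r : measurable [set x | dinf x y <= r].
Proof.
rewrite -[X in measurable X]setTI.
rewrite (_ : _ `&` _ = setT `&` (dinf^~ y @^-1` `]-oo, r])); last first.
  by apply/seteqP; split => x /=; rewrite in_itv.
exact: measurable_dinfl.
Qed.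

End SupDistance.

Section LebesgueBalls.
Context (R : realType) (p : nat).
Implicit Types x y t : p.-tuple R.
Variable lam : {measure set (p.-tuple R) -> \bar R}.
Hypothesis hlam : is_lebesgue_measure lam.

Lemma lebesgue_ball t (r : R) : 0 <= r ->
  lam [set x | dinf x t <= r] = ((2 * r) ^+ p)%:E.
Proof.
move=> r0; have := hlam [tuple tnth t i - r | i < p] [tuple tnth t i + r | i < p].
rewrite (_ : [set x | dinf x t <= r] = [set x | forall i : 'I_p,
    tnth [tuple tnth t i0 - r | i0 < p] i <= tnth x i <=
    tnth [tuple tnth t i0 + r | i0 < p] i]); last first.
  apply/seteqP; split => x /=.
    move=> /(dinf_leP _ _ r0) h i; have := h i.
    by rewrite !tnth_mktuple ler_distl.
  move=> h; apply/(dinf_leP _ _ r0) => i; have := h i.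
  by rewrite !tnth_mktuple ler_distl.
move=> ->; congr EFin.
rewrite (eq_bigr (fun=> 2 * r)); last first.
  move=> i _; rewrite !tnth_mktuple max_r; lra.
by rewrite prodr_const card_ord.
Qed.

(** Each point of the support of [F] lies in some ball on which the indicator times [c k] dominates
    [F] there, so the sum of all these layers dominates [F]. Full balls in place of shells make
    their volumes immediate. *)
Lemma layer_integral t (F : p.-tuple R -> R) (c r : nat -> R) :
  measurable_fun setT F -> (forall x, 0 <= F x) ->
  (forall k, 0 <= c k) -> (forall k, 0 <= r k) ->
  (forall x, F x != 0 -> exists k, dinf x t <= r k /\ F x <= c k) ->
  (\int[lam]_x (F x)%:E <= \sum_(0 <= k <oo) (c k * (2 * r k) ^+ p)%:E)%E.
Proof.
move=> mF F0 c0 r0 hF.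
pose L k x := (c k * \1_[set y | dinf y t <= r k] x)%:E : \bar R.
have L0 k x : (0 <= L k x)%E by rewrite lee_fin mulr_ge0.
have mL k : measurable_fun setT (L k).
  apply/measurable_EFinP; apply: measurable_funM => //.
  by apply: measurable_indic; exact: measurable_ball.
apply: (@le_trans _ _ (\int[lam]_x (\sum_(0 <= k <oo) L k x))%E).
  apply: ge0_le_integral => //.
  - by move=> x _; rewrite lee_fin.
  - exact/measurable_EFinP.
  - by apply: ge0_emeasurable_sum => // k _; exact: mL.
  move=> x _; have [Fx0|/hF[k [xk Fk]]] := eqVneq (F x) 0.
    by rewrite Fx0; apply: nneseries_ge0 => k _ _; exact: L0.
  apply: (@le_trans _ _ (L k x)).
    by rewrite lee_fin indicE mem_set// mulr1.
  apply: le_trans (nneseries_lim_ge k.+1 _); last by move=> i _ _; exact: L0.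
  rewrite big_nat_recr//= leeDr//; exact: sume_ge0.
rewrite integral_nneseries//; apply: lee_nneseries => [k _ _|k _].
  exact: integral_ge0.
rewrite /L; under eq_integral do rewrite EFinM.
have mB := measurable_ball t (r k).
rewrite ge0_integralZl_EFin//; last by apply/measurable_EFinP; exact: measurable_indic.
by rewrite integral_indic// setIT lebesgue_ball// EFinM.
Qed.

End LebesgueBalls.

(** * Integrals of powers of the distance over dyadic shells *)

Section PowerIntegrals.
Context (R : realType) (p : nat).
Implicit Types x y t : p.-tuple R.
Variable lam : {measure set (p.-tuple R) -> \bar R}.
Hypothesis hlam : is_lebesgue_measure lam.

Let sdist_gt0 x y : 0 < 1 + dinf x y.
Proof. by rewrite ltr_pwDl ?dinf_ge0. Qed.

Lemma measurable_decay y n : measurable_fun setT (fun x => (1 + dinf x y) ^- n).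
Proof.
under eq_fun do rewrite -exprVn -powR_inv1 ?ltW//.
apply: measurable_funX; apply: (measurableT_comp (measurable_powR _)).
by apply: measurable_funD => //; exact: measurable_dinfl.
Qed.

(** The shell [2^k <= 1 + dinf x t < 2^(k+1)] contributes at most [2^(-k(p+1)) * (2 * 2^(k+1))^p =
    4^p * 2^(-k)]. *)
Lemma integral_decay t :
  (\int[lam]_x ((1 + dinf x t) ^- p.+1)%:E <= (2 * 4 ^+ p)%:E)%E.
Proof.
apply: le_trans (layer_integral hlam (t := t) (c := fun k => (2 ^+ k) ^- p.+1)
  (r := fun k => 2 ^+ k.+1) (measurable_decay _ _) _ _ _ _) _.
- by move=> x; rewrite invr_ge0 exprn_ge0// ltW.
- by move=> k; rewrite invr_ge0 !exprn_ge0.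
- by move=> k; rewrite exprn_ge0.
- move=> x _; have h1 : 1 <= 1 + dinf x t by rewrite lerDl dinf_ge0.
  have [k /andP[k1 k2]] := dyadic_scale h1; exists k; split.
    by rewrite ltW// (le_lt_trans _ k2)// lerDr.
  rewrite lef_pV2 ?posrE ?exprn_gt0//.
  by rewrite lerXn2r ?nnegrE ?exprn_ge0// ltW// sdist_gt0.
rewrite (@eq_eseriesr _ _ (fun k => (4 ^+ p * 2^-1 ^+ k)%:E)); last first.
  move=> k _; congr EFin; rewrite exprVn.
  rewrite (_ : 2 * 2 ^+ k.+1 = 4 * 2 ^+ k); last by rewrite exprS; ring.
  have k0 : 2 ^+ k != 0 :> R by rewrite expf_neq0.
  rewrite exprMn exprS; field.
  by rewrite k0 expf_neq0.
rewrite eseries_geometric ?lee_fin; first by rewrite le_eqVlt; apply/orP; left; apply/eqP; field.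
by rewrite invr_ge0 invf_lt1// ler0n ltr1n.
Qed.

(** The exponent [p] is critical: each dyadic shell contributes at most [4^p] whatever its radius,
    and the shells [0] to [K] are counted. *)
Lemma integral_log K :
  (\int[lam]_x ((1 + ninf x <= 2 ^+ K)%R%:R * (1 + ninf x) ^- p)%:E <=
   (4 ^+ p * K.+1%:R)%:E)%E.
Proof.
apply: le_trans (layer_integral hlam (t := origin R p)
  (c := fun k => (k <= K)%N%:R * (2 ^+ k) ^- p)
  (r := fun k => 2 ^+ k.+1) _ _ _ _ _) _.
- apply: measurable_funM; last exact: measurable_decay.
  rewrite (_ : (fun x => _) = \1_[set x | 1 + ninf x <= 2 ^+ K]); last first.
    by apply/funext => x; rewrite indicE mem_setE.
  apply: measurable_indic.
  rewrite (_ : mkset _ = [set x | dinf x (origin R p) <= 2 ^+ K - 1]).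
    exact: measurable_ball.
  by apply/seteqP; split => x /=; rewrite lerBrDl.
- by move=> x; rewrite mulr_ge0// invr_ge0 exprn_ge0// ltW//; exact: sdist_gt0.
- by move=> k; rewrite mulr_ge0// invr_ge0 !exprn_ge0.
- by move=> k; rewrite exprn_ge0.
- move=> x; case: (boolP (_ <= 2 ^+ K)) => [xK _|]; last by rewrite mul0r eqxx.
  have h1 : 1 <= 1 + ninf x by rewrite lerDl ninf_ge0.
  have [k /andP[k1 k2]] := dyadic_scale h1; exists k; split.
    by rewrite ltW// (le_lt_trans _ k2)// lerDr.
  have -> : (k <= K)%N.
    by have := le_trans k1 xK; rewrite ler_eXn2l// ltr1n.
  rewrite !mul1r lef_pV2 ?posrE ?exprn_gt0//; last exact: sdist_gt0.
  by rewrite lerXn2r ?nnegrE ?exprn_ge0// ltW//; exact: sdist_gt0.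
rewrite (eseries_trunc (K := K)); last by move=> k kK; rewrite leqNgt kK !mul0r.
rewrite lee_fin big_mkord (eq_bigr (fun=> 4 ^+ p)); last first.
  move=> k _; rewrite -ltnS ltn_ord mul1r.
  rewrite (_ : 2 * 2 ^+ k.+1 = 4 * 2 ^+ k); last by rewrite exprS; ring.
  have k0 : 2 ^+ k != 0 :> R by rewrite expf_neq0.
  by rewrite exprMn; field; rewrite expf_neq0.
by rewrite sumr_const card_ord mulr_natr.
Qed.

(* The condition [q < 2 ^+ p] makes the sum over dyadic shells converge at 0. *)
Lemma integral_singular (F : p.-tuple R -> R) (H q : R) :
  measurable_fun setT F -> (forall x, 0 <= F x) -> 0 <= H ->
  0 <= q -> q < 2 ^+ p ->
  (forall x, F x != 0 -> 0 < ninf x <= 1) ->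
  (forall k x, (2 ^+ k.+1)^-1 < ninf x -> F x <= H * q ^+ k) ->
  (\int[lam]_x (F x)%:E < +oo)%E.
Proof.
move=> mF F0 H0 q0 qp Fsupp Fle.
apply: le_lt_trans (layer_integral hlam (t := origin R p)
  (c := fun k => H * q ^+ k) (r := fun k => (2 ^+ k)^-1) mF F0 _ _ _) _.
- by move=> k; rewrite mulr_ge0// exprn_ge0.
- by move=> k; rewrite invr_ge0 exprn_ge0.
- move=> x /Fsupp /andP[N0 N1].
  have h1 : 1 <= (ninf x)^-1 by rewrite invf_ge1.
  have [k /andP[k1 k2]] := dyadic_scale h1; exists k; split.
    by rewrite -[dinf _ _]invrK lef_pV2 ?posrE ?exprn_gt0 ?invr_gt0.
  by apply: Fle; rewrite -[ninf x]invrK ltf_pV2 ?posrE ?exprn_gt0 ?invr_gt0.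
have p0 : 2 ^+ p != 0 :> R by rewrite expf_neq0.
rewrite (@eq_eseriesr _ _ (fun k => (H * 2 ^+ p * (q / 2 ^+ p) ^+ k)%:E)); last first.
  move=> k _; congr EFin; have k0 : 2 ^+ k != 0 :> R by rewrite expf_neq0.
  rewrite !exprMn !exprVn -!exprM (mulnC k p); field.
  by rewrite expf_neq0.
rewrite eseries_geometric ?ltry// divr_ge0 ?exprn_ge0//=.
by rewrite ltr_pdivrMr ?exprn_gt0// mul1r.
Qed.

End PowerIntegrals.

(** * Gaussian tails and the size of the prior density *)

Section GaussPrior.
Context (R : realType) (p : nat).
Implicit Types x y t : p.-tuple R.

Lemma exp_decay (m : nat) (s : R) : 0 <= s ->
  (1 + s) ^+ m.+1 * expR (- s ^+ 2 / 2) <= m.+1%:R ^+ m.+1 * expR (1 / 2).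
Proof.
move=> s0.
(* [s - 1/2 <= s^2 / 2], and [exp s = (exp (s/k))^k >= (1 + s/k)^k]. *)
have e1 : expR (- s ^+ 2 / 2) <= expR (1 / 2) * expR (- s).
  by rewrite -expRD ler_expR; have := sqr_ge0 (s - 1); lra.
have e2 : (1 + s) ^+ m.+1 <= m.+1%:R ^+ m.+1 * expR s.
  have -> : expR s = expR (s / m.+1%:R) ^+ m.+1.
    by rewrite -expRM_natr divfK// pnatr_eq0.
  rewrite -exprMn lerXn2r ?nnegrE ?mulr_ge0 ?expR_ge0 ?addr_ge0//.
  apply: (@le_trans _ _ (m.+1%:R * (1 + s / m.+1%:R))).
    rewrite mulrDr mulr1 mulrCA divff ?pnatr_eq0// mulr1 lerD2r.
    by rewrite ler1n.
  by rewrite ler_wpM2l// expR_ge1Dx.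
apply: (@le_trans _ _ (m.+1%:R ^+ m.+1 * expR s * (expR (1 / 2) * expR (- s)))).
  by apply: ler_pM => //; rewrite ?expR_ge0 ?exprn_ge0 ?addr_ge0.
rewrite expRN; have := expR_gt0 s => es; rewrite le_eqVlt; apply/orP; left.
by apply/eqP; field; rewrite gt_eqF.
Qed.

Lemma gauss_norm_gt0 : 0 < (Num.sqrt (2 * pi)) ^+ p :> R.
Proof. by rewrite exprn_gt0// sqrtr_gt0 mulr_gt0// pi_gt0. Qed.

Lemma gauss_dens_gt0 t x : 0 < gauss_dens t x.
Proof. by rewrite divr_gt0 ?expR_gt0// gauss_norm_gt0. Qed.

(** Five powers pay for the loss in [cutoff_dist], and the other [p + 1] leave an integrable
    function by [integral_decay]; hence [exp_decay] at exponent [p + 6]. *)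
Lemma gauss_dens_decay : exists2 K : R, 0 <= K & forall t x,
  (1 + dinf x t) ^+ 5 * gauss_dens t x <= K * (1 + dinf x t) ^- p.+1.
Proof.
have c0 := gauss_norm_gt0.
exists ((p.+1 + 5)%:R ^+ (p.+1 + 5) * expR (1 / 2) / (Num.sqrt (2 * pi)) ^+ p).
  by rewrite divr_ge0 ?(ltW c0)// mulr_ge0 ?expR_ge0// exprn_ge0.
move=> t x; have s0 := dinf_ge0 x t.
have s1 : 0 < (1 + dinf x t) ^+ p.+1 by rewrite exprn_gt0// ltr_pwDl.
rewrite ler_pdivlMr// /gauss_dens mulrA -mulrAC ler_wpM2r ?invr_ge0 ?(ltW c0)//.
rewrite mulrAC -exprD addnC.
apply: le_trans (exp_decay (p + 5) s0); rewrite addSn.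
rewrite ler_wpM2l ?exprn_ge0 ?addr_ge0// ler_expR.
by have := dinf_sqr_le x t; lra.
Qed.

Lemma gauss_dens_le t x : gauss_dens t x <= ((Num.sqrt (2 * pi)) ^+ p)^-1.
Proof.
rewrite /gauss_dens ler_piMl ?invr_ge0 ?(ltW gauss_norm_gt0)//.
rewrite expR_le1 mulNr oppr_le0 divr_ge0//; apply: sumr_ge0 => i _.
exact: sqr_ge0.
Qed.

Lemma gauss_densC t x : gauss_dens t x = gauss_dens x t.
Proof.
rewrite /gauss_dens; congr (expR (- _ / 2) / _).
by apply: eq_bigr => i _; rewrite -sqrrN opprB.
Qed.

Lemma measurable_gauss_dens : measurable_fun setT
  (fun z : p.-tuple R * p.-tuple R => gauss_dens z.1 z.2).
Proof.
apply: measurable_funM => //; apply: (measurableT_comp (@measurable_expR R)).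
apply: measurable_funM => //; apply: measurableT_comp => //.
apply: measurable_sum => i; apply: measurable_funX.
apply: measurable_funB.
  exact: (measurableT_comp (measurable_tnth i) measurable_snd).
exact: (measurableT_comp (measurable_tnth i) measurable_fst).
Qed.

Variables (h : p.-tuple R -> R) (a b H : R).
Hypotheses (hp : (3 <= p)%N) (ha : 0 <= a) (hb : 0 < b).
Hypotheses (mh : measurable_fun setT h) (h0 : forall t, 0 <= h t).
Hypothesis (hH : forall t, h t <= H).
Local Notation w := (prior_dens h a b).

Lemma prior_dens_ge0 t : 0 <= w t.
Proof. by rewrite mulr_ge0// powR_ge0. Qed.

Lemma measurable_prior_dens : measurable_fun setT w.
Proof.
apply: measurable_funM => //; apply: (measurableT_comp (measurable_powR _)).
apply: measurable_funD => //; apply: measurable_sum => i.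
by apply: measurable_funX; exact: measurable_tnth.
Qed.

Let H0 : 0 <= H. Proof. exact: le_trans (hH (origin R p)). Qed.

Lemma prior_dens_le t (r : R) : 0 < r -> r <= a + sqnorm t ->
  w t <= H * r `^ (- b).
Proof.
move=> r0 rt; rewrite /prior_dens ler_pM// ?powR_ge0// !powRN.
rewrite lef_pV2 ?posrE ?powR_gt0//; last exact: lt_le_trans rt.
by apply: ge0_ler_powR; rewrite ?nnegrE ?(ltW hb) ?(ltW r0) ?(le_trans (ltW r0)).
Qed.

(** The density is at most [H * ninf t ^ (- 2 b)] with [2 b >= p - 2]. Since [1 <= ninf t], the
    exponent may be lowered to [p - 2], and [1 + ninf t <= 2 * ninf t] costs the factor
    [2^(p-2)]. *)
Lemma prior_dens_far t : p%:R / 2 - 1 <= b -> 1 <= ninf t ->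
  w t <= H * 2 ^+ (p - 2) * (1 + ninf t) ^- (p - 2).
Proof.
move=> hbp N1; have N0 : 0 <= ninf t by exact: ninf_ge0.
have Npos : 0 < ninf t by lra.
apply: le_trans (prior_dens_le (r := ninf t ^+ 2) _ _) _.
- by rewrite exprn_gt0.
- by rewrite (le_trans (ninf_sqr_le t))// lerDr.
rewrite -mulrA ler_wpM2l//.
rewrite powRN -powR_mulrn// -powRrM.
apply: (@le_trans _ _ (ninf t ^- (p - 2))).
  rewrite lef_pV2 ?posrE ?exprn_gt0 ?powR_gt0// -powR_mulrn// ler_powR//.
  by rewrite natrB ?(leq_trans _ hp)//; lra.
rewrite -[2 ^+ _]invrK -invfM lef_pV2 ?posrE ?mulr_gt0 ?invr_gt0 ?exprn_gt0//; last by lra.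
rewrite -exprVn -exprMn lerXn2r ?nnegrE//; last by lra.
by rewrite mulr_ge0//; lra.
Qed.

Variable lam : {measure set (p.-tuple R) -> \bar R}.
Hypothesis hlam : is_lebesgue_measure lam.

(** For [0 < a] the density is bounded by [H * a ^ (- b)]. For [a = 0] it is at most
    [H * 4^b * (4^b)^k] where [ninf t > 2^(-k-1)], and [4^b < 2^p] is exactly [b < p/2]. *)
Lemma prior_dens_near : 0 < a \/ (a = 0 /\ b < p%:R / 2) ->
  (\int[lam]_t (w t * (ninf t <= 1)%R%:R)%:E < +oo)%E.
Proof.
have mI : measurable_fun setT (fun t => (ninf t <= 1)%R%:R : R).
  rewrite (_ : (fun x => _) = \1_[set x | dinf x (origin R p) <= 1]); last first.
    by apply/funext => x; rewrite indicE mem_setE.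
  by apply: measurable_indic; exact: measurable_ball.
have mF : measurable_fun setT (fun t => w t * (ninf t <= 1)%R%:R).
  by apply: measurable_funM => //; exact: measurable_prior_dens.
have F0 t : 0 <= w t * (ninf t <= 1)%R%:R by rewrite mulr_ge0// prior_dens_ge0.
have S0 t : 0 <= sqnorm t by apply: sumr_ge0 => i _; exact: sqr_ge0.
case=> [a0|[a0 bp]].
  apply: le_lt_trans (layer_integral hlam (t := origin R p)
    (c := fun k => (H * a `^ (- b)) * (k <= 0)%N%:R) (r := fun=> 1) mF F0 _ _ _) _.
  - by move=> k; rewrite !mulr_ge0// powR_ge0.
  - by [].
  - move=> t; case: (boolP (ninf t <= 1)) => [t1 _|]; last by rewrite mulr0 eqxx.
    exists 0%N; split=> //; rewrite !mulr1.
    by apply: prior_dens_le => //; rewrite lerDl.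
  by rewrite (eseries_trunc (K := 0)) ?ltry// => -[]// k _; rewrite mulr0 mul0r.
apply: (integral_singular hlam (H := H * 4 `^ b) (q := 4 `^ b)) => //.
- by rewrite mulr_ge0// powR_ge0.
- rewrite -ltr_ln ?posrE ?powR_gt0 ?exprn_gt0// ln_powR lnXn//.
  rewrite (_ : 4 = 2 ^+ 2 :> R); last by rewrite expr2; lra.
  have l2 : 0 < ln 2 :> R by rewrite ln_gt0// ltr1n.
  by rewrite lnXn// -[ln 2 *+ 2]mulr_natl -[ln 2 *+ p]mulr_natl mulrA ltr_pM2r//; lra.
- move=> t; case: (boolP (ninf t <= 1)) => [t1|]; last by rewrite mulr0 eqxx.
  rewrite mulr1 andbT lt_neqAle ninf_ge0 andbT => wt; apply/eqP => N0.
  (* With the convention that [powR] of 0 is 0 at a nonzero exponent, the density takes the value 0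
     at the origin, so its support avoids that point. *)
  move: wt; rewrite /prior_dens a0 add0r /sqnorm big1; last first.
    move=> i _; have := dinf_coord t (origin R p) i.
    rewrite -/(ninf t) -N0 normr_le0 tnth_mktuple subr0 => /eqP ->.
    by rewrite expr0n.
  by rewrite powR0 ?mulr0 ?eqxx// oppr_eq0 gt_eqF.
- move=> k t kt; apply: (@le_trans _ _ (w t)).
    by rewrite ler_piMr ?prior_dens_ge0// lern1 leq_b1.
  have kp : 0 < 2 ^+ k.+1 :> R by rewrite exprn_gt0.
  apply: le_trans (prior_dens_le (r := (2 ^+ k.+1)^-1 ^+ 2) _ _) _.
  + by rewrite exprn_gt0// invr_gt0.
  + rewrite a0 add0r; apply: le_trans (ninf_sqr_le t).
    by rewrite lerXn2r ?nnegrE ?invr_ge0 ?ltW// (lt_trans _ kt)// invr_gt0.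
  rewrite -mulrA ler_wpM2l// -exprS exprVn -exprM mulnC exprM.
  rewrite (_ : 2 ^+ 2 = 4 :> R); last by rewrite expr2; lra.
  rewrite -powR_invn// -powRrM mulNr mulrN opprK mulrC powRrM powR_mulrn//.
Qed.

End GaussPrior.

(** * Logarithmic cutoffs *)

Section Cutoff.
Context (R : realType) (p : nat).
Implicit Types x y t : p.-tuple R.

Let ln2 : 0 < ln 2 :> R. Proof. by rewrite ln_gt0// ltr1n. Qed.

(** The index is shifted by one so that the scale is positive at [n = 0]; [cutoff n] vanishes as
    soon as [1 + ninf t] reaches [2^(n+1)]. *)
Definition cutoff_scale (n : nat) : R := n.+1%:R * ln 2.

Definition cutoff n t : R := Num.max 0 (1 - ln (1 + ninf t) / cutoff_scale n).

Lemma cutoff_scale_gt0 n : 0 < cutoff_scale n.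
Proof. by rewrite mulr_gt0. Qed.

Lemma cutoff_scaleE n : cutoff_scale n = ln (2 ^+ n.+1).
Proof. by rewrite /cutoff_scale mulr_natl lnXn. Qed.

Lemma cutoff_ge0 n t : 0 <= cutoff n t.
Proof. by rewrite le_max lexx. Qed.

Lemma cutoff_le1 n t : cutoff n t <= 1.
Proof.
rewrite ge_max ler01/= gerBl divr_ge0 ?(ltW (cutoff_scale_gt0 _))// ln_ge0//.
by rewrite lerDl ninf_ge0.
Qed.

Let sup_gt0 t : 0 < 1 + ninf t. Proof. by rewrite ltr_pwDl ?ninf_ge0. Qed.

Lemma cutoff_out n t : 2 ^+ n.+1 <= 1 + ninf t -> cutoff n t = 0.
Proof.
move=> h; apply: max_l; rewrite subr_le0 ler_pdivlMr ?cutoff_scale_gt0// mul1r.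
by rewrite cutoff_scaleE ler_ln ?posrE ?exprn_gt0.
Qed.

Lemma measurable_cutoff n : measurable_fun setT (cutoff n).
Proof.
apply: measurable_maxr => //; apply: measurable_funB => //.
apply: measurable_funM => //; apply: (measurableT_comp (@measurable_ln R)).
by apply: measurable_funD => //; exact: measurable_dinfl.
Qed.

Lemma cutoff_half (m : nat) : exists N, forall n t, (N <= n)%N ->
  ninf t <= m%:R -> 1 / 2 <= cutoff n t.
Proof.
exists (Num.truncn (2 * ln (1 + m%:R) / ln 2 : R)) => n t Nn tm.
rewrite le_max; apply/orP; right.
rewrite lerBrDl -lerBrDr ler_pdivrMr ?cutoff_scale_gt0//.
have h1 : 2 * ln (1 + m%:R) / ln 2 <= n.+1%:R :> R.
  by rewrite ltW// (lt_le_trans (truncnS_gt _))// ler_nat.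
have h2 : ln (1 + ninf t) <= ln (1 + m%:R).
  by rewrite ler_ln ?posrE ?lerD2l// ltr_pwDl.
by move: h1; rewrite ler_pdivrMr// /cutoff_scale; lra.
Qed.

(** Both directions use [ln u - ln v <= (u - v) / v]. The one that divides by [1 + ninf x] is
    converted by [1 + ninf t <= (1 + ninf x) * (1 + dinf x t)], so that the bound refers to [t], the
    variable of the prior. *)
Lemma ln_ninf_dist x t : `|ln (1 + ninf t) - ln (1 + ninf x)| <=
  dinf x t * (1 + dinf x t) / (1 + ninf t).
Proof.
have A0 := sup_gt0 x; have B0 := sup_gt0 t; have s0 := dinf_ge0 x t.
have := ninf_dist x t; rewrite ler_norml => /andP[d1 d2].
have lnle (u v : R) : 0 < u -> 0 < v -> ln u - ln v <= (u - v) / v.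
  move=> u0 v0; rewrite -ln_div ?posrE//.
  have -> : u / v = 1 + (u - v) / v by field; rewrite gt_eqF.
  by apply: le_ln1Dx; rewrite mulrBl divff ?gt_eqF// ltrBrDr addNr divr_gt0.
rewrite ler_norml; apply/andP; split.
  rewrite lerNl opprB; apply: le_trans (lnle _ _ A0 B0) _.
  rewrite ler_pM2r ?invr_gt0//; nra.
apply: le_trans (lnle _ _ B0 A0) _.
rewrite ler_pdivrMr// mulrAC ler_pdivlMr//.
have h1 : ninf t - ninf x <= dinf x t by lra.
have h2 : 1 + ninf t <= (1 + ninf x) * (1 + dinf x t).
  by have := ninf_ge0 x; nra.
rewrite -mulrA; apply: (@le_trans _ _ (dinf x t * (1 + ninf t))).
  by rewrite opprD addrACA subrr add0r ler_wpM2r// ltW.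
by rewrite ler_wpM2l// mulrC.
Qed.

(* The first term accounts for [t] near the support of [cutoff n]; beyond it
   [cutoff n t = 0], and [cutoff n x] can only be nonzero if
   [1 + ninf t <= 2 * dinf x t], which buys one more power of [1 + ninf t]. *)
Definition cutoff_weight n t : R :=
  (1 + ninf t <= 2 ^+ (n.+1 + n.+1))%R%:R * (1 + ninf t) ^- 2 +
  (1 + ninf t) ^- 3.

Lemma cutoff_weight_ge0 n t : 0 <= cutoff_weight n t.
Proof.
by rewrite addr_ge0 ?mulr_ge0 ?invr_ge0 ?exprn_ge0// ltW.
Qed.

Lemma cutoff_dist n x t : (cutoff n t - cutoff n x) ^+ 2 <=
  2 / cutoff_scale n ^+ 2 * (1 + dinf x t) ^+ 5 * cutoff_weight n t.
Proof.
have A0 := sup_gt0 x; have B0 := sup_gt0 t; have s0 := dinf_ge0 x t.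
have L0 := cutoff_scale_gt0 n.
have max0_dist (u v : R) : `|Num.max 0 u - Num.max 0 v| <= `|u - v|.
  by case: (leP 0 u); case: (leP 0 v) => h1 h2; rewrite ler_norml; case: (ger0P (u - v)); lra.
have base : (cutoff n t - cutoff n x) ^+ 2 <=
    dinf x t ^+ 2 * (1 + dinf x t) ^+ 2 / ((1 + ninf t) ^+ 2 * cutoff_scale n ^+ 2).
  rewrite -real_normK ?num_real//.
  have -> : dinf x t ^+ 2 * (1 + dinf x t) ^+ 2 /
      ((1 + ninf t) ^+ 2 * cutoff_scale n ^+ 2) =
    (dinf x t * (1 + dinf x t) / (1 + ninf t) / cutoff_scale n) ^+ 2.
    by field; rewrite !gt_eqF.
  have := ln_ninf_dist x t; set e := _ / (1 + ninf t) => De.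
  rewrite lerXn2r ?nnegrE ?normr_ge0//.
    by rewrite divr_ge0 ?(ltW L0)// divr_ge0 ?(ltW B0)// mulr_ge0// addr_ge0.
  apply: le_trans (max0_dist _ _) _.
  rewrite [X in `|X|](_ : _ = (ln (1 + ninf x) - ln (1 + ninf t)) / cutoff_scale n);
    last by ring.
  rewrite normrM (gtr0_norm (x := _^-1)) ?invr_gt0//.
  by rewrite ler_pM2r ?invr_gt0// distrC.
have B2 : 0 <= (1 + ninf t) ^- 2 by rewrite invr_ge0 exprn_ge0// ltW.
have B3 : 0 <= (1 + ninf t) ^- 3 by rewrite invr_ge0 exprn_ge0// ltW.
have S0 : 0 <= 2 / cutoff_scale n ^+ 2 * (1 + dinf x t) ^+ 5.
  by rewrite mulr_ge0 ?exprn_ge0 ?addr_ge0// divr_ge0// exprn_ge0// ltW.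
have S5 : dinf x t ^+ 2 * (1 + dinf x t) ^+ 2 <= 2 * (1 + dinf x t) ^+ 5.
  have u1 : 1 <= (1 + dinf x t) by lra.
  apply: (@le_trans _ _ ((1 + dinf x t) ^+ 2 * (1 + dinf x t) ^+ 2)).
    by rewrite ler_wpM2r ?exprn_ge0 ?addr_ge0// lerXn2r ?nnegrE ?addr_ge0//; lra.
  have h4 : 0 <= (1 + dinf x t) ^+ 4 by rewrite exprn_ge0 ?addr_ge0.
  rewrite -exprD exprS; nra.
rewrite /cutoff_weight; case: (lerP _ (2 ^+ _)) => [tn|tn].
  apply: le_trans base _; rewrite mul1r.
  apply: (@le_trans _ _ (2 / cutoff_scale n ^+ 2 * (1 + dinf x t) ^+ 5 * (1 + ninf t) ^- 2)); last first.
    by rewrite ler_wpM2l// lerDl.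
  rewrite [leRHS](_ : _ = 2 * (1 + dinf x t) ^+ 5 /
    ((1 + ninf t) ^+ 2 * cutoff_scale n ^+ 2)); last by field; rewrite !gt_eqF.
  by rewrite ler_wpM2r// invr_ge0 mulr_ge0// exprn_ge0// ltW.
rewrite mul0r add0r.
have n2 : 2 <= 2 ^+ n.+1 :> R by rewrite exprS ler_peMr// exprn_ege1// ler1n.
have tn2 : 2 ^+ n.+1 * 2 ^+ n.+1 < 1 + ninf t by rewrite -exprD.
rewrite cutoff_out; last by nra.
have [xn|xn] := lerP (2 ^+ n.+1) (1 + ninf x).
  by rewrite cutoff_out// subrr expr0n mulr_ge0.
(* As [2 <= 2^(n+1)], one has [2 * (1 + ninf x) < 2^(n+1) * 2^(n+1) < 1 + ninf t]: the step covers
   at least half of [1 + ninf t]. *)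
have Bs : 1 + ninf t <= 2 * dinf x t.
  have := ninf_dist x t; rewrite ler_norml => /andP[d1 d2]; nra.
(* The 0 is turned back into [cutoff n t] so that [base] applies here too. *)
rewrite -(cutoff_out (n := n) (t := t)); last by nra.
apply: le_trans base _.
rewrite [leRHS](_ : _ = 2 * (1 + dinf x t) ^+ 5 / (1 + ninf t) /
  ((1 + ninf t) ^+ 2 * cutoff_scale n ^+ 2)); last by field; rewrite !gt_eqF.
rewrite ler_wpM2r//; first by rewrite invr_ge0 mulr_ge0// exprn_ge0// ltW.
rewrite ler_pdivlMr//.
apply: (@le_trans _ _ (dinf x t ^+ 2 * (1 + dinf x t) ^+ 2 * (2 * dinf x t))).
  by rewrite ler_wpM2l// mulr_ge0 ?exprn_ge0 ?addr_ge0.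
have -> : dinf x t ^+ 2 * (1 + dinf x t) ^+ 2 * (2 * dinf x t) =
  2 * (dinf x t ^+ 3 * (1 + dinf x t) ^+ 2) by ring.
rewrite ler_wpM2l// (exprD _ 3 2) ler_wpM2r ?exprn_ge0 ?addr_ge0//.
by rewrite lerXn2r ?nnegrE ?addr_ge0//; lra.
Qed.

End Cutoff.

(** Tonelli requires a bundled sigma-finite measure. Balls of integer radius have finite volume, and
    an equality of measures lets the bundled one be substituted for [lam]. *)
Lemma lebesgue_sigma_finite (R : realType) (p : nat)
    (lam : {measure set (p.-tuple R) -> \bar R}) : is_lebesgue_measure lam ->
  exists lamS : {sigma_finite_measure set (p.-tuple R) -> \bar R},
    lam = lamS :> {measure set (p.-tuple R) -> \bar R}.
Proof.
move=> hlam.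
have sf : sigma_finite setT lam.
  exists (fun n => [set x | dinf x (origin R p) <= n%:R]).
    apply/esym/seteqP; split => // x _.
    exists (Num.truncn (dinf x (origin R p))).+1 => //=.
    by rewrite ltW// truncnS_gt.
  move=> n; split; first exact: measurable_ball.
  by rewrite (lebesgue_ball hlam)// ltry.
case: lam hlam sf => m mm hlam sf.
pose M := Measure_isSigmaFinite.Build _ _ _ (Measure.Pack mm) sf.
pose lamS : {sigma_finite_measure set (p.-tuple R) -> \bar R} :=
  HB.pack m mm M.
by exists lamS.
Qed.

(** * Energy of the cutoffs and finiteness of the marginal density *)

Section Dirichlet.
Context (R : realType) (p : nat).
Hypothesis hp : (3 <= p)%N.
Implicit Types x y t : p.-tuple R.
Variable lam : {sigma_finite_measure set (p.-tuple R) -> \bar R}.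
Hypothesis hlam : is_lebesgue_measure lam.
Variables (w : p.-tuple R -> R) (H : R).
Hypotheses (mw : measurable_fun setT w) (w0 : forall t, 0 <= w t) (H0 : 0 <= H).
Hypothesis near : (\int[lam]_t (w t * (ninf t <= 1)%R%:R)%:E < +oo)%E.
Hypothesis far : forall t, 1 <= ninf t -> w t <= H * (1 + ninf t) ^- (p - 2).

Let sup_gt0 t : 0 < 1 + ninf t. Proof. by rewrite ltr_pwDl ?ninf_ge0. Qed.

Let near_part t : R := w t * (ninf t <= 1)%R%:R.

Let near_ge0 t : 0 <= near_part t. Proof. by rewrite mulr_ge0. Qed.

Let measurable_near (r : R) : measurable_fun setT (fun t => (ninf t <= r)%R%:R : R).
Proof.
rewrite (_ : (fun x => _) = \1_[set x | dinf x (origin R p) <= r]); last first.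
  by apply/funext => x; rewrite indicE mem_setE.
by apply: measurable_indic; exact: measurable_ball.
Qed.

Let mnear : measurable_fun setT near_part.
Proof. exact: measurable_funM. Qed.

Let W := fine (\int[lam]_t (near_part t)%:E)%E.

Let intW : (\int[lam]_t (near_part t)%:E)%E = W%:E.
Proof.
rewrite fineK// ge0_fin_numE//; apply: integral_ge0 => t _.
by rewrite lee_fin.
Qed.

Let W0 : 0 <= W.
Proof. by rewrite fine_ge0//; apply: integral_ge0 => t _; rewrite lee_fin. Qed.

Lemma weight_split t : w t <= near_part t + H * (1 + ninf t) ^- (p - 2).
Proof.
have B0 : 0 <= H * (1 + ninf t) ^- (p - 2).
  by rewrite mulr_ge0// invr_ge0 exprn_ge0// ltW.
rewrite /near_part; case: (lerP (ninf t) 1) => t1; first by rewrite mulr1 lerDl.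
by rewrite mulr0 add0r far// ltW.
Qed.

Lemma weight_split_bounded t : w t <= near_part t + H.
Proof.
apply: le_trans (weight_split t) _; rewrite lerD2l ler_piMr// invf_le1.
  by rewrite exprn_ege1// lerDl ninf_ge0.
by rewrite exprn_gt0.
Qed.

Lemma measurable_cutoff_weight n : measurable_fun setT (@cutoff_weight R p n).
Proof.
apply: measurable_funD; last exact: measurable_decay.
apply: measurable_funM; last exact: measurable_decay.
rewrite (_ : (fun t => _) = (fun t => (ninf t <= 2 ^+ (n.+1 + n.+1) - 1)%R%:R)).
  exact: measurable_near.
by apply/funext => t; rewrite lerBrDl.
Qed.

(** Inside the unit ball the weight is at most 2, which gives [2 * W]. Outside,
    [(1 + ninf t)^-(p-2)] raises the powers 2 and 3 to [p] and [p + 1]: the former grows with the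
    number of dyadic shells, linearly in [n], and the latter converges. *)
Lemma integral_cutoff_weight : exists2 K : R, 0 <= K & forall n,
  (\int[lam]_t (w t * cutoff_weight n t)%:E <= (K * n.+1%:R)%:E)%E.
Proof.
have p4 : 0 <= 4 ^+ p :> R by rewrite exprn_ge0.
exists (2 * W + H * (5 * 4 ^+ p)); first by rewrite addr_ge0 ?mulr_ge0.
move=> n.
pose F1 t : R := (1 + ninf t <= 2 ^+ (n.+1 + n.+1))%R%:R * (1 + ninf t) ^- p.
pose F2 t : R := (1 + ninf t) ^- p.+1.
have B0 k t : 0 <= (1 + ninf t) ^- k by rewrite invr_ge0 exprn_ge0// ltW.
have F10 t : 0 <= F1 t by rewrite mulr_ge0.
have F20 t : 0 <= F2 t by exact: B0.
have mF2 : measurable_fun setT F2 by exact: measurable_decay.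
have mF1 : measurable_fun setT F1.
  apply: measurable_funM; last exact: measurable_decay.
  rewrite (_ : (fun t => _) = (fun t => (ninf t <= 2 ^+ (n.+1 + n.+1) - 1)%R%:R)).
    exact: measurable_near.
  by apply/funext => t; rewrite lerBrDl.
apply: (@le_trans _ _ (\int[lam]_t (2 * near_part t + H * (F1 t + F2 t))%:E)%E).
  apply: ge0_le_integral => //.
  - by move=> t _; rewrite lee_fin mulr_ge0// cutoff_weight_ge0.
  - apply/measurable_EFinP; apply: measurable_funM => //.
    exact: measurable_cutoff_weight.
  - apply/measurable_EFinP; apply: measurable_funD; first exact: measurable_funM.
    by apply: measurable_funM => //; exact: measurable_funD.
  move=> t _; rewrite lee_fin.
  have V2 : cutoff_weight n t <= 2.
    have B1 k : (1 + ninf t) ^- k <= 1.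
      by rewrite invf_le1 ?exprn_gt0// exprn_ege1// lerDl ninf_ge0.
    rewrite /cutoff_weight (_ : 2 = 1 + 1)//; apply: lerD => //.
    by case: (1 + ninf t <= _); rewrite ?mul1r ?mul0r ?B1.
  apply: (@le_trans _ _ ((near_part t + H * (1 + ninf t) ^- (p - 2)) * cutoff_weight n t)).
    by rewrite ler_wpM2r ?cutoff_weight_ge0// weight_split.
  rewrite mulrDl; apply: lerD; first by rewrite mulrC ler_wpM2r.
  rewrite -mulrA ler_wpM2l// /cutoff_weight mulrDr mulrCA /F1 /F2.
  rewrite -!invfM -!exprD.
  by rewrite subnK ?(leq_trans _ hp)// -[3%N]/(2 + 1)%N addnA subnK ?(leq_trans _ hp)// addn1.
under eq_integral do rewrite EFinD EFinM [X in (_ + X)%E]EFinM.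
rewrite ge0_integralD//; last 4 first.
- by move=> t _; rewrite -EFinM lee_fin mulr_ge0.
- by apply: emeasurable_funM => //; exact/measurable_EFinP.
- by move=> t _; rewrite -EFinM lee_fin mulr_ge0// addr_ge0.
- by apply: emeasurable_funM => //; apply/measurable_EFinP; exact: measurable_funD.
rewrite ge0_integralZl_EFin//; last 2 first.
- by move=> t _; rewrite lee_fin.
- exact/measurable_EFinP.
rewrite ge0_integralZl_EFin//; last 2 first.
- by move=> t _; rewrite lee_fin addr_ge0.
- by apply/measurable_EFinP; exact: measurable_funD.
under [X in (_ + _ * X)%E]eq_integral do rewrite EFinD.
rewrite ge0_integralD//; last 4 first.
- by move=> t _; rewrite lee_fin.
- exact/measurable_EFinP.
- by move=> t _; rewrite lee_fin.
- exact/measurable_EFinP.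
rewrite intW.
apply: (@le_trans _ _ (2 * W + H * (4 ^+ p * (n.+1 + n.+1).+1%:R + 2 * 4 ^+ p))%:E).
  rewrite [leRHS]EFinD (EFinM 2) (EFinM H) [X in (_ <= _ + _ * X)%E]EFinD.
  rewrite leeD2l// lee_wpmul2l ?lee_fin//; apply: leeD.
    exact: (integral_log hlam).
  exact: (integral_decay hlam).
rewrite lee_fin [leRHS]mulrDl; apply: lerD.
  by rewrite ler_peMr ?mulr_ge0// ler1n.
(* With [m = n + 1 >= 1] the claim is [(2 m + 1) + 2 <= 5 m], up to the factor [4^p]. *)
rewrite -mulrA ler_wpM2l// -[(n.+1 + n.+1).+1]addn1 !natrD.
have : 1 <= n.+1%:R :> R by rewrite ler1n.
nra.
Qed.

(** Integration over the step leaves [w t * cutoff_weight n t] with a factor of order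
    [1 / cutoff_scale n ^+ 2], that is [1 / (n + 1)^2]; the integral over [t] gives back one factor
    [n + 1]. *)
Lemma cutoff_dirichlet : exists K : R, forall n,
  (\int[lam]_t \int[lam]_x ((cutoff n t - cutoff n x) ^+ 2 *
     (gauss_dens t x * w t))%:E <= (K / n.+1%:R)%:E)%E.
Proof.
have [KG KG0 gaussK] := gauss_dens_decay R p.
have [K1 K10 weightK] := integral_cutoff_weight.
have p4 : 0 <= 4 ^+ p :> R by rewrite exprn_ge0.
exists (2 * KG * (2 * 4 ^+ p) * K1 / ln 2 ^+ 2) => n.
have L0 := cutoff_scale_gt0 R n.
pose c : R := 2 / cutoff_scale R n ^+ 2 * KG * (2 * 4 ^+ p).
have c0 : 0 <= c by rewrite !mulr_ge0// invr_ge0 exprn_ge0// ltW.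
have mg : measurable_fun setT (fun z : p.-tuple R * p.-tuple R =>
    ((cutoff n z.1 - cutoff n z.2) ^+ 2 * (gauss_dens z.1 z.2 * w z.1))%:E).
  apply/measurable_EFinP; apply: measurable_funM.
    apply: measurable_funX; apply: measurable_funB.
      exact: (measurableT_comp (@measurable_cutoff R p n) measurable_fst).
    exact: (measurableT_comp (@measurable_cutoff R p n) measurable_snd).
  apply: measurable_funM; first exact: measurable_gauss_dens.
  exact: (measurableT_comp mw measurable_fst).
have g0 z : (0 <= ((cutoff n z.1 - cutoff n z.2) ^+ 2 * (gauss_dens z.1 z.2 * w z.1))%:E)%E.
  by rewrite lee_fin mulr_ge0 ?sqr_ge0// mulr_ge0// ltW// gauss_dens_gt0.
have inner t : (\int[lam]_x ((cutoff n t - cutoff n x) ^+ 2 *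
     (gauss_dens t x * w t))%:E <= c%:E * (w t * cutoff_weight n t)%:E)%E.
  pose e : R := 2 / cutoff_scale R n ^+ 2 * KG * (w t * cutoff_weight n t).
  have e0 : 0 <= e.
    rewrite mulr_ge0 ?mulr_ge0 ?cutoff_weight_ge0// invr_ge0 exprn_ge0// ltW//.
  apply: (@le_trans _ _ (\int[lam]_x (e%:E * ((1 + dinf x t) ^- p.+1)%:E))%E).
    apply: ge0_le_integral => //.
    - by move=> x _; exact: (g0 (t, x)).
    - exact: (measurableT_comp mg (pair1_measurable t)).
    - by apply: emeasurable_funM => //; apply/measurable_EFinP; exact: measurable_decay.
    move=> x _; rewrite -EFinM lee_fin.
    have G0 : 0 <= gauss_dens t x * w t by rewrite mulr_ge0// ltW// gauss_dens_gt0.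
    apply: le_trans (ler_wpM2r G0 (cutoff_dist n x t)) _.
    rewrite [leLHS](_ : _ = 2 / cutoff_scale R n ^+ 2 * (w t * cutoff_weight n t) *
      ((1 + dinf x t) ^+ 5 * gauss_dens t x)); last by ring.
    rewrite [leRHS](_ : _ = 2 / cutoff_scale R n ^+ 2 * (w t * cutoff_weight n t) *
      (KG * (1 + dinf x t) ^- p.+1)); last by rewrite /e; ring.
    rewrite ler_wpM2l//.
    by rewrite mulr_ge0 ?mulr_ge0 ?cutoff_weight_ge0// invr_ge0 exprn_ge0// ltW.
  rewrite ge0_integralZl_EFin//; last 2 first.
  - by move=> x _; rewrite lee_fin invr_ge0 exprn_ge0// addr_ge0// dinf_ge0.
  - by apply/measurable_EFinP; exact: measurable_decay.
  apply: le_trans (lee_wpmul2l _ (integral_decay hlam t)) _; first by rewrite lee_fin.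
  by rewrite -!EFinM lee_fin /e /c le_eqVlt; apply/orP; left; apply/eqP; ring.
have mV : measurable_fun setT (fun t => (w t * cutoff_weight n t)%:E).
  apply/measurable_EFinP; apply: measurable_funM => //.
  exact: measurable_cutoff_weight.
apply: (@le_trans _ _ (\int[lam]_t (c%:E * (w t * cutoff_weight n t)%:E))%E).
  apply: ge0_le_integral => //.
  - by move=> t _; apply: integral_ge0 => x _; exact: (g0 (t, x)).
  - exact: (measurable_fun_fubini_tonelli_F _ mg g0).
  - exact: emeasurable_funM.
rewrite ge0_integralZl_EFin//; last first.
  by move=> t _; rewrite lee_fin mulr_ge0// cutoff_weight_ge0.
apply: le_trans (lee_wpmul2l _ (weightK n)) _; first by rewrite lee_fin.
have m0 : n.+1%:R != 0 :> R by rewrite pnatr_eq0.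
have l0 : ln 2 != 0 :> R by rewrite gt_eqF// ln_gt0// ltr1n.
rewrite -EFinM lee_fin /c /cutoff_scale; move: m0; move: (n.+1%:R : R) => m m0.
by rewrite le_eqVlt; apply/orP; left; apply/eqP; field; rewrite m0 l0.
Qed.

Lemma cutoff_integrable n : (\int[lam]_t (cutoff n t ^+ 2 * w t)%:E < +oo)%E.
Proof.
pose D t : R := H * (ninf t <= 2 ^+ n.+1)%R%:R.
have D0 t : 0 <= D t by rewrite mulr_ge0.
have mD : measurable_fun setT D by apply: measurable_funM => //.
apply: (@le_lt_trans _ _ (\int[lam]_t ((near_part t)%:E + (D t)%:E))%E).
  apply: ge0_le_integral => //.
  - by move=> t _; rewrite lee_fin mulr_ge0// sqr_ge0.
  - apply/measurable_EFinP; apply: measurable_funM => //; apply: measurable_funX.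
    exact: measurable_cutoff.
  - by apply: emeasurable_funD; exact/measurable_EFinP.
  move=> t _; rewrite -EFinD lee_fin /D; case: (lerP _ (2 ^+ n.+1)) => tn.
    rewrite mulr1; apply: le_trans (weight_split_bounded t).
    rewrite ler_piMl// expr_le1// ?cutoff_ge0//; exact: cutoff_le1.
  rewrite cutoff_out; last by rewrite (le_trans (ltW tn))// lerDr.
  by rewrite expr0n mul0r mulr0 addr0.
rewrite ge0_integralD//; last 4 first.
- by move=> t _; rewrite lee_fin.
- exact/measurable_EFinP.
- by move=> t _; rewrite lee_fin.
- exact/measurable_EFinP.
rewrite intW lte_add_pinfty ?ltry// /D.
under eq_integral do rewrite EFinM.
rewrite ge0_integralZl_EFin//; last exact/measurable_EFinP.
rewrite (eq_integral (fun t => (\1_[set x | dinf x (origin R p) <= 2 ^+ n.+1] t)%:E)); last first.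
  by move=> t _; rewrite indicE mem_setE.
rewrite integral_indic//; last exact: measurable_ball.
by rewrite setIT (lebesgue_ball hlam) ?exprn_ge0// -EFinM ltry.
Qed.

(** A bound uniform in [t] is enough to make risks finite, so the Gaussian integral is not
    evaluated. *)
Lemma gauss_mass : exists K : R, forall t,
  (\int[lam]_x (gauss_dens t x)%:E <= K%:E)%E.
Proof.
have [KG KG0 gaussK] := gauss_dens_decay R p.
exists (KG * (2 * 4 ^+ p)) => t.
have md : measurable_fun setT (fun x => ((1 + dinf x t) ^- p.+1)%:E).
  by apply/measurable_EFinP; exact: measurable_decay.
apply: (@le_trans _ _ (\int[lam]_x (KG%:E * ((1 + dinf x t) ^- p.+1)%:E))%E).
  apply: ge0_le_integral => //.
  - by move=> x _; rewrite lee_fin ltW// gauss_dens_gt0.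
  - apply/measurable_EFinP.
    exact: (measurableT_comp (@measurable_gauss_dens R p) (pair1_measurable t)).
  - exact: emeasurable_funM.
  move=> x _; rewrite -EFinM lee_fin; apply: le_trans (gaussK t x).
  rewrite ler_peMl ?(ltW (gauss_dens_gt0 _ _))// exprn_ege1// lerDl dinf_ge0//.
rewrite ge0_integralZl_EFin//; last first.
  by move=> x _; rewrite lee_fin invr_ge0 exprn_ge0// addr_ge0// dinf_ge0.
by rewrite EFinM lee_wpmul2l ?lee_fin// (integral_decay hlam).
Qed.

(** In the unit ball the Gaussian density is bounded and the prior has finite mass; elsewhere the
    prior density is bounded by [H], and the Gaussian is integrated over its mean by symmetry. *)
Lemma gauss_marginal_fin x : (\int[lam]_t (gauss_dens t x * w t)%:E < +oo)%E.
Proof.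
have [K gK] := gauss_mass.
pose c : R := ((Num.sqrt (2 * pi)) ^+ p)^-1.
have c0 : 0 <= c by rewrite invr_ge0 ltW// gauss_norm_gt0.
have G0 t : 0 <= gauss_dens t x by rewrite ltW// gauss_dens_gt0.
have mG : measurable_fun setT (fun t => gauss_dens t x).
  exact: (measurableT_comp (@measurable_gauss_dens R p) (pair2_measurable x)).
apply: (@le_lt_trans _ _ (\int[lam]_t (c%:E * (near_part t)%:E + H%:E * (gauss_dens t x)%:E))%E).
  apply: ge0_le_integral => //.
  - by move=> t _; rewrite lee_fin mulr_ge0.
  - by apply/measurable_EFinP; exact: measurable_funM.
  - by apply: emeasurable_funD; apply: emeasurable_funM => //; exact/measurable_EFinP.
  move=> t _; rewrite -!EFinM -EFinD lee_fin.
  apply: le_trans (ler_wpM2l (G0 t) (weight_split_bounded t)) _.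
  by rewrite mulrDr [_ * H]mulrC lerD2r ler_wpM2r// gauss_dens_le.
rewrite ge0_integralD//; last 4 first.
- by move=> t _; rewrite -EFinM lee_fin mulr_ge0.
- by apply: emeasurable_funM => //; exact/measurable_EFinP.
- by move=> t _; rewrite -EFinM lee_fin mulr_ge0.
- by apply: emeasurable_funM => //; exact/measurable_EFinP.
rewrite !ge0_integralZl_EFin//; last 4 first.
- by move=> t _; rewrite lee_fin.
- exact/measurable_EFinP.
- by move=> t _; rewrite lee_fin.
- exact/measurable_EFinP.
rewrite intW -EFinM lte_add_pinfty ?ltry//.
apply: lte_mul_pinfty => //; under eq_integral do rewrite gauss_densC.
exact: le_lt_trans (gK x) (ltry _).
Qed.

End Dirichlet.

(** * Gaussian model *)

Section FormalPosteriorGauss.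
Context (R : realType) (p : nat).
Variable lam : {sigma_finite_measure set (p.-tuple R) -> \bar R}.
Variable w : p.-tuple R -> R.
Hypotheses (mw : measurable_fun setT w) (w0 : forall t, 0 <= w t).

Definition joint_dens (z : p.-tuple R * p.-tuple R) : R :=
  gauss_dens z.1 z.2 * w z.1.

Lemma joint_dens_ge0 z : 0 <= joint_dens z.
Proof. by rewrite mulr_ge0// ltW// gauss_dens_gt0. Qed.

Lemma measurable_joint_dens : measurable_fun setT joint_dens.
Proof.
apply: measurable_funM; first exact: measurable_gauss_dens.
exact: (measurableT_comp mw measurable_fst).
Qed.

Let mgaussr (t : p.-tuple R) : measurable_fun setT (fun x => (gauss_dens t x)%:E).
Proof.
apply/measurable_EFinP.
exact: (measurableT_comp (@measurable_gauss_dens R p) (pair1_measurable t)).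
Qed.

Lemma Pmodel_weight (t : p.-tuple R) B : measurable B ->
  (Pmodel lam t B * (w t)%:E = \int[lam]_(x in B) (joint_dens (t, x))%:E)%E.
Proof.
move=> mB; rewrite /Pmodel -ge0_integralZr ?lee_fin//.
  exact: measurable_funTS.
by move=> x _; rewrite lee_fin ltW// gauss_dens_gt0.
Qed.

Lemma formal_posteriorE Q :
  is_formal_posterior lam w Q <-> disintegrates lam joint_dens Q.
Proof.
suff E A B : measurable A -> measurable B ->
   (\int[lam]_(t in A) (Pmodel lam t B * (w t)%:E) =
    \int[lam]_(t in A) \int[lam]_(x in B) (joint_dens (t, x))%:E)%E /\
   (\int[lam]_t ((\int[lam]_(x in B) (Q x A * (gauss_dens t x)%:E)) * (w t)%:E) =
    \int[lam]_t \int[lam]_(x in B) (Q x A * (joint_dens (t, x))%:E))%E.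
  by split => h A B mA mB; have [e1 e2] := E A B mA mB;
    [rewrite -e1 -e2|rewrite e1 e2]; exact: h.
move=> mA mB; split; apply: eq_integral => t _; first exact: Pmodel_weight.
rewrite -ge0_integralZr ?lee_fin//.
- by apply: eq_integral => x _; rewrite -muleA -EFinM.
- apply: measurable_funTS; apply: emeasurable_funM => //.
  exact: measurable_kernel.
- by move=> x _; rewrite mule_ge0// lee_fin ltW// gauss_dens_gt0.
Qed.

(** The Gaussian density is positive everywhere, so a zero marginal at [x] would force [w = 0]
    almost everywhere, against the infinite mass of the prior. *)
Lemma marginal_gt0 x : (\int[lam]_t (w t)%:E = +oo)%E ->
  (0 < \int[lam]_t (joint_dens (t, x))%:E)%E.
Proof.
move=> winf; rewrite lt_neqAle; apply/andP; split; last first.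
  by apply: integral_ge0 => t _; rewrite lee_fin joint_dens_ge0.
apply/eqP => /esym j0.
have mj : measurable_fun setT (fun t => (joint_dens (t, x))%:E).
  apply/measurable_EFinP.
  exact: (measurableT_comp measurable_joint_dens (pair2_measurable x)).
have : (\int[lam]_t `|(joint_dens (t, x))%:E| = 0)%E.
  rewrite -[RHS]j0; apply: eq_integral => t _.
  by rewrite gee0_abs// lee_fin joint_dens_ge0.
move=> /(ae_eq_integral_abs lam measurableT mj) jae.
have : (\int[lam]_t (w t)%:E = \int[lam]_t 0)%E.
  apply: ge0_ae_eq_integral => //.
  - exact/measurable_EFinP.
  - by move=> t _; rewrite lee_fin.
  apply: filterS jae => t /(_ I) /eqP; rewrite eqe mulf_eq0 => + _.
  by rewrite gt_eqF ?gauss_dens_gt0//= => /eqP ->.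
by rewrite winf integral0.
Qed.

End FormalPosteriorGauss.

(** * Measurability and bounds for the Bayes estimator *)

Section BayesEstimator.
Context (R : realType) (p : nat).
Variables (Q : R.-pker (p.-tuple R) ~> (p.-tuple R)).
Variables (phi : p.-tuple R -> R) (C : R).
Hypotheses (mphi : measurable_fun setT phi) (phiC : forall t, `|phi t| <= C).

(** Adding [C] makes the integrand nonnegative, which is what the measurability of kernel integrals
    and [ae_posterior_integral] ask for; [fine] loses nothing as [phi] is bounded and [Q x] a
    probability. *)
Lemma bayes_est_shift x :
  (\int[Q x]_t (phi t + C)%:E = (bayes_est Q phi x + C)%:E)%E.
Proof.
have Q1 : Q x setT = 1%E by exact: prob_kernel.
have iphi : (Q x).-integrable setT (EFin \o phi).
  apply: measurable_bounded_integrable => //; first by rewrite Q1 ltry.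
  exists C; split; first exact: num_real.
  by move=> y Cy t _; rewrite /= (le_trans (phiC t))// ltW.
have iC : (Q x).-integrable setT (EFin \o cst C).
  apply: measurable_bounded_integrable => //; first by rewrite Q1 ltry.
  exists `|C|; split; first exact: num_real.
  by move=> y Cy t _; rewrite /= ltW.
rewrite (integralD_EFin _ iphi iC)//= [X in (_ + X)%E](integral_cst _ measurableT).
by rewrite Q1 mule1 EFinD /bayes_est fineK//; exact: integrable_fin_num iphi.
Qed.

Let shift_ge0 t : 0 <= phi t + C.
Proof. by have := phiC t; rewrite ler_norml; lra. Qed.

Lemma measurable_bayes_est : measurable_fun setT (bayes_est Q phi).
Proof.
rewrite (_ : bayes_est Q phi = fun x => fine (\int[Q x]_t (phi t + C)%:E)%E - C).
  apply: measurable_funB => //; apply: measurableT_comp => //.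
  apply: measurable_fun_integral_kernel.
  - by move=> U mU; exact: measurable_kernel.
  - by move=> t; rewrite lee_fin.
  - by apply/measurable_EFinP; exact: measurable_funD.
by apply/funext => x; rewrite bayes_est_shift/= addrK.
Qed.

Lemma bayes_est_bounded x : `|bayes_est Q phi x| <= C.
Proof.
have h0 : (0 <= \int[Q x]_t (phi t + C)%:E)%E.
  by apply: integral_ge0 => t _; rewrite lee_fin.
have h1 : (\int[Q x]_t (phi t + C)%:E <= \int[Q x]_t (cst (C + C)%:E t))%E.
  apply: ge0_le_integral => //.
  - by move=> t _; rewrite lee_fin.
  - by apply/measurable_EFinP; exact: measurable_funD.
  - by move=> t _; rewrite lee_fin lerD2r; have := phiC t; rewrite ler_norml; lra.
rewrite integral_cst// prob_kernel mule1 bayes_est_shift lee_fin in h1.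
by rewrite bayes_est_shift lee_fin in h0; rewrite ler_norml; lra.
Qed.

End BayesEstimator.

Theorem theorem5p2 (R : realType) (p : nat) (hp : (3 <= p)%N)
    (lam : {measure set (p.-tuple R) -> \bar R})
    (hlam : is_lebesgue_measure lam)
    (a b : R) (ha : 0 <= a) (hb : 0 < b)
    (h : p.-tuple R -> R) (hmeas : measurable_fun setT h)
    (hpos : forall t, 0 <= h t) (hbdd : exists C : R, forall t, h t <= C)
    (himproper : (\int[lam]_t (prior_dens h a b t)%:E = +oo)%E)
    (hab : (0 < a /\ p%:R / 2 - 1 <= b <= p%:R / 2) \/
           (a = 0 /\ p%:R / 2 - 1 <= b < p%:R / 2)) :
  strongly_admissible lam (prior_dens h a b).
Proof.
have [lamS elam] := lebesgue_sigma_finite hlam; subst lam.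
have [H hH] := hbdd.
have hbp : p%:R / 2 - 1 <= b by case: hab => -[_ /andP[]].
have hab' : 0 < a \/ (a = 0 /\ b < p%:R / 2).
  by case: hab => -[a0 /andP[_ bp]]; [left|right].
pose w := prior_dens h a b.
have w0 t : 0 <= w t by exact: prior_dens_ge0.
have mw : measurable_fun setT w by exact: measurable_prior_dens.
have near := prior_dens_near hb hmeas hpos hH hlam hab'.
have far t := prior_dens_far hp ha hb hpos hH (t := t) hbp.
have H20 : 0 <= H * 2 ^+ (p - 2).
  by rewrite mulr_ge0 ?exprn_ge0// (le_trans _ (hH (origin R p))).
have mfin := gauss_marginal_fin hlam mw w0 H20 near far.
have j0 := joint_dens_ge0 w0; have mj := measurable_joint_dens mw.
split; [|split].
- have [F [UF mF Ffin]] := sigma_finite_marginal j0 mj mfin.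
  exists F => // n; split=> //; rewrite /marginal.
  (* Tonelli turns the marginal measure of [F n] into the integral over [F n] of the marginal
     density. *)
  rewrite (eq_integral (fun t => \int[lamS]_(x in F n) (joint_dens w (t, x))%:E)%E).
    by rewrite (int_slice _ j0 mj).
  by move=> t _; exact: Pmodel_weight.
- have [Q QP] := disintegration_exists j0 mj mfin (origin R p)
    (fun x => marginal_gt0 mw w0 x himproper).
  by exists Q; exact/(formal_posteriorE _ w0).
move=> Q /(formal_posteriorE _ w0) QP phi mphi [C phiC].
have C0 : 0 <= C by exact: le_trans (phiC (origin R p)).
have mpsi := measurable_bayes_est Q mphi phiC.
have mean : {ae lamS, forall x, ((bayes_est Q phi x + C)%:E *
    \int[lamS]_t (gauss_dens t x * w t)%:E =
    \int[lamS]_t ((phi t + C) * (gauss_dens t x * w t))%:E)%E}.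
  have := ae_posterior_integral j0 mj mfin QP (phi := fun t => phi t + C)
    (M := C + C).
  move=> /(_ (addr_ge0 C0 C0)) /(_ (measurable_funD mphi (measurable_cst _))).
  have pC t : 0 <= phi t + C <= C + C.
    by have := phiC t; rewrite ler_norml; lra.
  move=> /(_ pC); apply: filterS => x.
  by rewrite (bayes_est_shift Q mphi phiC).
have [F0 massF] := gauss_mass hlam.
have [K dirK] := cutoff_dirichlet hp hlam mw w0 H20 near far.
move=> s ms sdom.
apply: (@blyth_admissible _ _ _ lamS (fun z => gauss_dens z.1 z.2) w _ _ _ _
  phi (bayes_est Q phi) C mphi mpsi phiC (bayes_est_bounded Q mphi phiC)
  mfin mean F0 massF (@cutoff R p) K
  (fun m => [set t | dinf t (origin R p) <= m%:R])) => //.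
- by move=> z; rewrite ltW// gauss_dens_gt0.
- exact: measurable_gauss_dens.
- exact: measurable_cutoff.
- exact: (cutoff_integrable hlam mw w0 H20 near far).
- by move=> m; exact: measurable_ball.
- move=> t; exists (Num.truncn (dinf t (origin R p))).+1 => /=.
  by rewrite ltW// truncnS_gt.
- move=> m; have [N hN] := cutoff_half R p m.
  by exists N => n t Nn; exact: hN.
Qed.
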